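(* Let $(\bar u,\bar z)$, with $\bar u=\boldsymbol S\bar z$, be the solution of the state and control constrained problem (P), let $\bar\mu\in\mathcal M(\Omega)$ be a Lagrange multiplier associated with the state constraint (together with an adjoint variable $\bar\xi\in L^{p'}(\Omega)$, satisfying the optimality system of (P) recalled in the context), and for $\gamma>0$ let $(\bar u^\gamma,\bar z^\gamma)$, with $\bar u^\gamma=\boldsymbol S\bar z^\gamma$, be the solution of the regularized problem (P$^\gamma$). Then $$\alpha\|\bar z-\bar z^\gamma\|_{L^2(\Omega)}^2+\|\bar u-\bar u^\gamma\|_{L^2(\Omega)}^2+\gamma\|(\bar u^\gamma)_+\|_{L^2(\Omega)}^2\le \frac1\gamma\|\hat\mu\|_{L^2(\Omega)}^2+\langle\bar\mu,\bar u^\gamma\rangle_{\mathcal M(\Omega),C_0(\Omega)},$$ and hence $$\|(\bar u^\gamma)_+\|_{L^2(\Omega)}\le\sqrt{\frac2\gamma}\,\max\Big(\frac1\gamma\|\hat\mu\|_{L^2(\Omega)}^2,\ \langle\bar\mu,(\bar u^\gamma)_+\rangle_{\mathcal M(\Omega),C_0(\Omega)}\Big)^{1/2}.$$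
   Context: Setting. $\Omega\subset\mathbb R^N$ ($N\ge1$) is a bounded Lipschitz domain satisfying the exterior cone condition, $0<s<1$, $\alpha>0$, $u_d\in L^2(\Omega)$, and $p$ is a real number with $2\le p<\infty$ and $p>N/(2s)$; $p'=p/(p-1)$. $C_0(\Omega)$ is the space of continuous functions on $\overline\Omega$ vanishing on $\partial\Omega$, and $\mathcal M(\Omega)=C_0(\Omega)^\star$ is the space of Radon measures on $\Omega$ with $\langle\mu,v\rangle_{\mathcal M(\Omega),C_0(\Omega)}=\int_\Omega v\,d\mu$. $(w)_+=\max(w,0)$. $\widetilde W^{s,2}_0(\Omega)=\{u\in W^{s,2}(\mathbb R^N): u=0\text{ in }\mathbb R^N\setminus\Omega\}$. The fractional Laplacian is $(-\Delta)^su(x)=C_{N,s}\,\mathrm{P.V.}\int_{\mathbb R^N}\frac{u(x)-u(y)}{|x-y|^{N+2s}}dy$ with $C_{N,s}=\frac{s2^{2s}\Gamma(\frac{2s+N}{2})}{\pi^{N/2}\Gamma(1-s)}$, and $$\mathcal E(u,v)=\frac{C_{N,s}}2\int_{\mathbb R^N}\int_{\mathbb R^N}\frac{(u(x)-u(y))(v(x)-v(y))}{|x-y|^{N+2s}}\,dx\,dy .$$ $(-\Delta)^s_D$ is the realization of $(-\Delta)^s$ in $L^2(\Omega)$ with exterior condition $u=0$ in $\mathbb R^N\setminus\Omega$: $(-\Delta)_D^s(u|_\Omega)=(-\Delta)^su$ in $\Omega$ for $u\in\widetilde W^{s,2}_0(\Omega)$ with $(-\Delta)^su\in L^2(\Omega)$.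 Let $Z=L^p(\Omega)$ and $U=\{u\in\widetilde W^{s,2}_0(\Omega)\cap C_0(\Omega):(-\Delta)^s_D(u|_\Omega)\in L^p(\Omega)\}$. For $z\in Z$, $\boldsymbol Sz\in U$ denotes the unique weak solution of $(-\Delta)^su=z$ in $\Omega$, $u=0$ in $\mathbb R^N\setminus\Omega$, i.e. $\mathcal E(\boldsymbol Sz,v)=\int_\Omega zv$ for all $v\in\widetilde W^{s,2}_0(\Omega)$. $Z_{ad}\subset Z$ is nonempty, closed and convex. Problem (P): minimize $\frac12\|\boldsymbol Sz-u_d\|_{L^2(\Omega)}^2+\frac\alpha2\|z\|_{L^2(\Omega)}^2$ over $z\in Z_{ad}$ subject to $\boldsymbol Sz\le0$ in $\overline\Omega$ (the upper bound for the state is $u_b\equiv0$). Optimality system of (P): with $\bar u=\boldsymbol S\bar z$, (i) $\langle\bar\xi,(-\Delta)^s_Dv\rangle_{L^{p'}(\Omega),L^p(\Omega)}=(\bar u-u_d,v)_{L^2(\Omega)}+\int_\Omega v\,d\bar\mu$ for all $v\in U$; (ii) $\langle\bar\xi+\alpha\bar z,z-\bar z\rangle_{L^{p'}(\Omega),L^p(\Omega)}\ge0$ for all $z\in Z_{ad}$; (iii) $\bar\mu\ge0$, $\bar u\le0$ in $\Omega$, and $\int_\Omega\bar u\,d\bar\mu=0$. Problem (P$^\gamma$), $\gamma>0$: for a fixed $\hat\mu\in L^2(\Omega)$ with $\hat\mu\ge0$, minimize $\frac12\|\boldsymbol Sz-u_d\|_{L^2(\Omega)}^2+\frac\alpha2\|z\|_{L^2(\Omega)}^2+\frac1{2\gamma}\|(\hat\mu+\gamma\boldsymbol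 Sz)_+\|_{L^2(\Omega)}^2$ over $z\in Z_{ad}$ (no state constraint). *)

(* Defs.v *)
From HB Require Import structures.
From mathcomp Require Import all_boot all_order all_algebra.
From mathcomp Require Import all_classical all_reals all_analysis.
From mathcomp Require Import measurable_realfun lra.
Set Implicit Arguments.
Unset Strict Implicit.
Unset Printing Implicit Defensive.
Import Order.TTheory GRing.Theory Num.Theory.
Import numFieldNormedType.Exports.
Local Open Scope classical_set_scope.
Local Open Scope ring_scope.

(* R^N is 'rV[R]_N with the library's (product) topology, equipped with its
   Borel sigma-algebra. *)
HB.instance Definition _ (R : realType) (n : nat) :=
  @isMeasurable.Build (sigma_display (@open 'rV[R]_n)) 'rV[R]_n
    <<s @open 'rV[R]_n >> (@sigma_algebra0 _ setT _)
    (@sigma_algebraC _ (@open 'rV[R]_n)) (@sigma_algebra_bigcup _ setT _).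

Section borel_rV.
Variable R : realType.

Lemma open_measurable_rV n (A : set 'rV[R]_n) : open A -> measurable A.
Proof. by move=> oA; exact: sub_sigma_algebra. Qed.

Lemma measurable_coord n (i : 'I_n) :
  measurable_fun [set: 'rV[R]_n] (fun x => x ord0 i).
Proof.
apply: (measurability _ (RGenOpens.measurableE R)) => _ [_ [a [b ->]] <-].
rewrite setTI; apply: open_measurable_rV.
apply: open_comp; last exact: interval_open.
by move=> x _; exact: coord_continuous.
Qed.

Lemma measurable_fun_rVP d (T : measurableType d) n (f : T -> 'rV[R]_n) :
  measurable_fun [set: T] f <->
  forall i, measurable_fun [set: T] (fun t => f t ord0 i).
Proof.
split=> [mf i|mf].
  exact: (measurableT_comp (measurable_coord i) mf).
apply: (@measurability _ _ _ _ _ _ (@open 'rV[R]_n)) => // _ [A oA <-].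
rewrite setTI.
pose box (q : 'rV[rat]_n * nat) : set 'rV[R]_n :=
  [set x | forall i, `|x ord0 i - ratr (q.1 ord0 i)| < q.2.+1%:R^-1].
pose F q : set T := [set t | box q `<=` A /\ box q (f t)].
have -> : f @^-1` A = \bigcup_q F q.
  apply/seteqP; split=> [t Aft|t [q _ [qA fq]]]; last exact: qA.
  have /nbhs_ballP[e /= e0 eA] : nbhs (f t) A by exact: open_nbhs_nbhs.
  have e20 : 0 < e / 2 by rewrite divr_gt0.
  have [k] := ltr_add_invr e20; rewrite add0r => ke.
  have : 0 < k.+1%:R^-1 :> R by rewrite invr_gt0.
  move: ke; set r := k.+1%:R^-1 => ke r0.
  have /choice[q qP] : forall i : 'I_n, exists q : rat,
      ratr q \in `]f t ord0 i - r, f t ord0 i + r[.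
    by move=> i; have /rat_in_itvoo[q ?] : f t ord0 i - r < f t ord0 i + r;
      [lra|exists q].
  exists (\row_i q i, k) => //; split=> [x xq|i] /=.
    apply: eA; split => // i j; rewrite (ord1 i) /ball /=.
    have := xq j; have := qP j.
    rewrite /= mxE in_itv /= -/r !ltr_norml => /andP[? ?] /andP[? ?].
    by apply/andP; split; lra.
  have := qP i; rewrite mxE in_itv/= -/r ltr_norml => /andP[? ?].
  by apply/andP; split; lra.
apply: countable_bigcupT_measurable => [|q]; first exact: countableP.
have [qA|nqA] := pselect (box q `<=` A); last first.
  by rewrite (_ : F q = set0)// -subset0 => t [].
rewrite (_ : F q = \bigcap_i
    [set t | `|f t ord0 i - ratr (q.1 ord0 i)| < q.2.+1%:R^-1]); last first.
  by apply/seteqP; split=> [t [_ fq] i _|t fq]; [|split => // i]; exact: fq.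
apply: fin_bigcap_measurable => // i _.
rewrite -[X in measurable X]setTI.
apply: (measurable_fun_ltr (f := fun t => `|f t ord0 i - ratr (q.1 ord0 i)|)) => //.
apply: measurableT_comp => //; exact: measurable_funB.
Qed.

End borel_rV.

Section lebesgue_rV.
Variable R : realType.

Definition cons_rV n (p : measurableTypeR R * 'rV[R]_n) : 'rV[R]_n.+1 :=
  row_mx (const_mx p.1 : 'rV_1) p.2.

Lemma measurable_cons_rV n : measurable_fun [set: _] (@cons_rV n).
Proof.
apply/measurable_fun_rVP => i; rewrite /cons_rV.
case: (splitP (i : 'I_(1 + n))) => j ij.
- have -> : i = lshift n j :> 'I_(1 + n) by exact/val_inj.
  rewrite (_ : (fun _ => _) = fst).
    exact: (@measurable_fst _ _ (measurableTypeR R) 'rV[R]_n).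
  by apply/funext => p; rewrite (@row_mxEl _ 1 1 n) mxE.
- have -> : i = rshift 1 j :> 'I_(1 + n) by exact/val_inj.
  rewrite (_ : (fun _ => _) = (fun x : 'rV[R]_n => x ord0 j) \o snd).
    exact: measurableT_comp (measurable_coord j) measurable_snd.
  by apply/funext => p; rewrite /= (@row_mxEr _ 1 1 n).
Qed.

Section lebesgue_step.
Variables (n : nat) (m : {sigma_finite_measure set 'rV[R]_n -> \bar R}).
Local Open Scope ereal_scope.

Definition lebesgue_rV_step : set 'rV[R]_n.+1 -> \bar R :=
  pushforward (lebesgue_measure \x m) (@cons_rV n).

Let step0 : lebesgue_rV_step set0 = 0.
Proof. by rewrite /lebesgue_rV_step /pushforward preimage_set0 measure0. Qed.

Let step_ge0 A : 0 <= lebesgue_rV_step A.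
Proof. by rewrite /lebesgue_rV_step /pushforward; exact: measure_ge0. Qed.

Let step_sigma_additive : semi_sigma_additive lebesgue_rV_step.
Proof.
have mcons A : measurable A -> measurable (@cons_rV n @^-1` A).
  by move=> mA; rewrite -[X in measurable X]setTI; exact: measurable_cons_rV.
move=> F mF tF mUF; rewrite /lebesgue_rV_step /pushforward preimage_bigcup.
apply: measure_semi_sigma_additive.
- by move=> k; exact: mcons.
- apply/trivIsetP => i j _ _ ij; rewrite -preimage_setI.
  by move/trivIsetP : tF => /(_ _ _ _ _ ij) ->//; rewrite preimage_set0.
- by rewrite -preimage_bigcup; exact: mcons.
Qed.

HB.instance Definition _ := isMeasure.Build _ _ _ lebesgue_rV_step
  step0 step_ge0 step_sigma_additive.

Let step_sigma_finite : sigma_finite setT lebesgue_rV_step.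
Proof.
have /sigma_finiteP[F [TF ndF Foo]] := sigma_finiteT (@lebesgue_measure R).
have /sigma_finiteP[G [TG ndG Goo]] := sigma_finiteT m.
pose g (x : 'rV[R]_n.+1) : measurableTypeR R * 'rV[R]_n :=
  (x ord0 ord0, rsubmx (x : 'rV_(1 + n))).
have mg : measurable_fun setT g.
  apply/measurable_fun_pairP; split.
    exact: measurable_coord.
  apply/measurable_fun_rVP => i.
  rewrite (_ : (fun _ => _) = fun x : 'rV[R]_n.+1 => x ord0 (rshift 1 i)).
    exact: measurable_coord.
  by apply/funext => x; rewrite /= mxE.
have gK p : g (cons_rV p) = p.
  case: p => a x; rewrite /g /cons_rV row_mxKr; congr pair.
  rewrite (_ : ord0 = lshift n ord0 :> 'I_(1 + n)); last exact/val_inj.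
  by rewrite (@row_mxEl _ 1 1 n) mxE.
exists (fun k => g @^-1` (F k `*` G k)).
  apply/seteqP; split=> // x _.
  have [a _ Fa] : (\bigcup_i F i) (g x).1 by rewrite -TF.
  have [b _ Gb] : (\bigcup_i G i) (g x).2 by rewrite -TG.
  exists (maxn a b) => //; split.
    by move: Fa; exact/subsetPset/ndF/leq_maxl.
  by move: Gb; exact/subsetPset/ndG/leq_maxr.
move=> k; have [mF Fk] := Foo k; have [mG Gk] := Goo k; split.
  by rewrite -[X in measurable X]setTI; apply: mg => //; exact: measurableX.
rewrite /lebesgue_rV_step /pushforward (_ : _ @^-1` _ = F k `*` G k); last first.
  by rewrite -comp_preimage (_ : g \o _ = id)//; apply/funext => p; exact: gK.
by rewrite product_measure1E// lte_mul_pinfty// ge0_fin_numE.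
Qed.

HB.instance Definition _ := Measure_isSigmaFinite.Build _ _ _ lebesgue_rV_step
  step_sigma_finite.

End lebesgue_step.

(* N-dimensional Lebesgue measure as the N-fold product of the Lebesgue measure
   on R. *)
Fixpoint lebesgue_rV n : {sigma_finite_measure set 'rV[R]_n -> \bar R} :=
  match n with
  | 0 => \d_(0 : 'rV[R]_0)
  | n'.+1 => lebesgue_rV_step (lebesgue_rV n')
  end.

Lemma lebesgue_rV_box n (a b : 'I_n -> R) : (forall i, a i <= b i) ->
  lebesgue_rV n [set x | forall i, x ord0 i \in `[a i, b i]] =
  (\prod_(i < n) (b i - a i))%:E.
Proof.
elim: n a b => [|n IHn] a b ab.
  rewrite big_ord0 /= diracE mem_set//; last by case.
rewrite [LHS]/= /lebesgue_rV_step /pushforward.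
set B := [set x : 'rV[R]_n | forall i : 'I_n,
  x ord0 i \in `[a (lift ord0 i), b (lift ord0 i)]].
rewrite (_ : _ @^-1` _ = `[a ord0, b ord0]%classic `*` B); last first.
  have c0 (p : measurableTypeR R * 'rV[R]_n) : cons_rV p ord0 ord0 = p.1.
    have <- : (const_mx p.1 : 'rV[R]_1) ord0 ord0 = p.1 by rewrite mxE.
    rewrite -(@row_mxEl _ 1 1 n _ p.2); congr (row_mx _ _ _ _).
    exact/val_inj.
  have cS (p : measurableTypeR R * 'rV[R]_n) i :
      cons_rV p ord0 (lift ord0 i) = p.2 ord0 i.
    rewrite -(@row_mxEr _ 1 1 n (const_mx p.1)); congr (row_mx _ _ _ _).
    exact/val_inj.
  apply/seteqP; split=> [p pab|p [p1 p2] i].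
    by split=> [|i] /=; [rewrite -c0|rewrite -cS]; exact: pab.
  by have [j ->|->] := unliftP ord0 i; [rewrite cS; exact: p2|rewrite c0].
have mB : measurable B.
  rewrite (_ : B = \bigcap_i [set x : 'rV[R]_n |
      x ord0 i \in `[a (lift ord0 i), b (lift ord0 i)]]).
    apply: fin_bigcap_measurable => // i _.
    have := @measurable_coord R n i measurableT _
      (measurable_itv `[a (lift ord0 i), b (lift ord0 i)]).
    by rewrite setTI.
  by apply/seteqP; split=> [x xB i _|x xB i]; exact: xB.
rewrite product_measure1E//.
rewrite big_ord_recl EFinM -IHn//; congr (_ * _)%E.
apply: etrans (lebesgue_measure_itv `[a ord0, b ord0]) _.
rewrite /= lte_fin.
have := ab ord0; rewrite le_eqVlt => /predU1P[->|->]; last by rewrite EFinB.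
by rewrite ltxx subrr.
Qed.

End lebesgue_rV.
Arguments lebesgue_rV {R} n.

Section domains.
Context {R : realType} {N : nat}.
Implicit Types (Omega : set 'rV[R]_N) (x y : 'rV[R]_N).

Definition dotv x y : R := \sum_(i < N) x ord0 i * y ord0 i.

(* The Euclidean norm; `|x| is the sup norm on 'rV[R]_N. *)
Definition enorm x : R := Num.sqrt (dotv x x).

Definition boundary Omega : set 'rV[R]_N := closure Omega `\` Omega°.

(* Near x0 the set is the strict epigraph, in the unit direction e, of a
   Lipschitz function phi of the component orthogonal to e; phi is only
   evaluated on the hyperplane orthogonal to e. *)
Definition lipschitz_boundary_at Omega x0 : Prop :=
  exists (e : 'rV[R]_N) (phi : 'rV[R]_N -> R) (r L : R),
    [/\ enorm e = 1, 0 < r,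
        forall x y, `|phi x - phi y| <= L * enorm (x - y) &
        forall x, enorm (x - x0) < r ->
          Omega x <-> phi (x - dotv x e *: e) < dotv x e].

Definition bounded_lipschitz_domain Omega : Prop :=
  [/\ Omega !=set0, open Omega, connected Omega, bounded_set Omega &
      forall x0, boundary Omega x0 -> lipschitz_boundary_at Omega x0].

(* The closed finite right circular cone with vertex x0, axis e, height h and
   opening half-angle arccos c. *)
Definition finite_cone x0 (e : 'rV[R]_N) (h c : R) : set 'rV[R]_N :=
  [set x | enorm (x - x0) <= h /\ c * enorm (x - x0) <= dotv (x - x0) e].

Definition exterior_cone_condition Omega : Prop :=
  forall x0, boundary Omega x0 ->
    exists (e : 'rV[R]_N) (h c : R),
      [/\ enorm e = 1, 0 < h, 0 < c < 1 &
          finite_cone x0 e h c `&` closure Omega = [set x0]].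

End domains.

(* Euler's Gamma function, for a > 0. *)
Definition Gamma {R : realType} (a : R) : R :=
  \int[@lebesgue_measure R]_(t in `]0, +oo[) (t `^ (a - 1) * expR (- t)).

Section fractional.
Context {R : realType} {N : nat}.
Variables (Omega : set 'rV[R]_N) (s : R).
Implicit Types (u v f z : 'rV[R]_N -> R).

(* L^p(Omega).  Elements of function spaces are represented by functions on
   R^N; only their values on Omega matter here. *)
Definition in_Lp (p : R) f : Prop :=
  (f \_ Omega)%FUN \in Lfun (lebesgue_rV N) p%:E.

Definition L2norm f : R :=
  fine ('N[lebesgue_rV N]_2%:E [EFin \o (f \_ Omega)%FUN])%E.

Definition fracLap_const : R :=
  s * 2 `^ (2 * s) * Gamma ((2 * s + N%:R) / 2) /
  (pi `^ (N%:R / 2) * Gamma (1 - s)).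

Definition frac_kernel (x y : 'rV[R]_N) : R := (enorm (x - y) `^ (N%:R + 2 * s))^-1.

(* W^{s,2}(R^N) *)
Definition in_Ws2 u : Prop :=
  u \in Lfun (lebesgue_rV N) 2%:E /\
  (\int[lebesgue_rV N \x lebesgue_rV N]_z
     ((u z.1 - u z.2) ^+ 2 * frac_kernel z.1 z.2)%:E < +oo)%E.

(* \widetilde W^{s,2}_0(Omega) *)
Definition in_Ws20 u : Prop :=
  in_Ws2 u /\ {ae lebesgue_rV N, forall x, ~ Omega x -> u x = 0}.

Definition energy u v : R :=
  fracLap_const / 2 *
  \int[(lebesgue_rV N \x lebesgue_rV N)%E]_z
    ((u z.1 - u z.2) * (v z.1 - v z.2) * frac_kernel z.1 z.2).

(* The integral under the principal value, cut off at distance e. *)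
Definition fracLap_trunc (e : R) u (x : 'rV[R]_N) : R :=
  fracLap_const *
  \int[lebesgue_rV N]_(y in [set y | e < enorm (x - y)])
    ((u x - u y) * frac_kernel x y).

(* (-Delta)^s_D u = f.  For u in W^{s,2} the principal value is a limit in the
   sense of functionals on \widetilde W^{s,2}_0(Omega): pointwise it need not
   exist, and where it exists almost everywhere it can miss singular parts of
   (-Delta)^s u. *)
Definition is_fracLapD u f : Prop :=
  [/\ in_Ws20 u, in_Lp 2 f &
      forall v, in_Ws20 v ->
        \int[lebesgue_rV N]_x (v x * fracLap_trunc e u x) @[e --> 0^'+] -->
        \int[lebesgue_rV N]_(x in Omega) (f x * v x)].

(* C_0(Omega), as a condition on the restriction of u to the closure. *)
Definition in_C0 u : Prop :=
  {within closure Omega, continuous u} /\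
  forall x, boundary Omega x -> u x = 0.

Definition in_U (p : R) u : Prop :=
  [/\ in_Ws20 u, in_C0 u & exists2 f, in_Lp p f & is_fracLapD u f].

(* u = S z, as a relation between z and its weak solution u, so that existence
   and uniqueness of the latter are not presupposed. *)
Definition is_state (p : R) z u : Prop :=
  in_U p u /\
  forall v, in_Ws20 v ->
    energy u v = \int[lebesgue_rV N]_(x in Omega) (z x * v x).

(* A nonempty closed convex subset of L^p(Omega).  Sequential closedness makes
   the set stable under modification on null sets. *)
Definition admissible_controls (p : R) (Zad : set ('rV[R]_N -> R)) : Prop :=
  [/\ Zad !=set0,
      forall z, Zad z -> in_Lp p z,
      forall (zn : nat -> 'rV[R]_N -> R) z,
        (forall n, Zad (zn n)) -> in_Lp p z ->
        ('N[lebesgue_rV N]_p%:E [EFin \o ((zn n \- z)%R \_ Omega)%FUN])%E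
          @[n --> \oo] --> 0%E ->
        Zad z &
      forall z1 z2 (t : R), Zad z1 -> Zad z2 -> 0 <= t <= 1 ->
        Zad (fun x => t * z1 x + (1 - t) * z2 x)].

Section control_problems.
Variables (p alpha gamma : R) (ud muhat : 'rV[R]_N -> R).
Variable Zad : set ('rV[R]_N -> R).

Definition cost u z : R :=
  2^-1 * L2norm (u \- ud) ^+ 2 + alpha / 2 * L2norm z ^+ 2.

Definition feasible u z : Prop :=
  [/\ Zad z, is_state p z u & forall x, closure Omega x -> u x <= 0].

Definition is_solution u z : Prop :=
  feasible u z /\ forall u' z', feasible u' z' -> cost u z <= cost u' z'.

Definition reg_cost u z : R :=
  cost u z + (2 * gamma)^-1 * L2norm (fun x => muhat x + gamma * u x)^\+ ^+ 2.

Definition reg_feasible u z : Prop := Zad z /\ is_state p z u.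

Definition is_reg_solution u z : Prop :=
  reg_feasible u z /\
  forall u' z', reg_feasible u' z' -> reg_cost u z <= reg_cost u' z'.

End control_problems.
End fractional.

Section radon_measures.
Context {R : realType} {N : nat}.
Implicit Types (Omega A : set 'rV[R]_N) (mu : {charge set 'rV[R]_N -> \bar R}).

(* M(Omega): finite signed Borel measures concentrated on Omega (these are
   automatically regular). *)
Definition in_M Omega mu : Prop :=
  forall A, measurable A -> A `&` Omega = set0 -> mu A = 0%E.

Definition charge_ge0 mu : Prop := forall A, measurable A -> (0 <= mu A)%E.

(* Integration against a signed measure through its Jordan decomposition. *)
Definition charge_integral mu (D : set 'rV[R]_N) (v : 'rV[R]_N -> R) : R :=
  let P := cid (Hahn_decomposition mu) in
  let Q := cid (projT2 P) in
  \int[jordan_pos (projT2 Q)]_(x in D) v x -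
  \int[jordan_neg (projT2 Q)]_(x in D) v x.

End radon_measures.

Section optimality.
Context {R : realType} {N : nat}.
Variables (Omega : set 'rV[R]_N) (s p alpha : R) (ud : 'rV[R]_N -> R).
Variable Zad : set ('rV[R]_N -> R).

(* L^{p/(p-1)}-L^p pairings are written as integrals over Omega. *)
Definition optimality_system (u z xi : 'rV[R]_N -> R)
    (mu : {charge set 'rV[R]_N -> \bar R}) : Prop :=
  [/\ forall v f, in_U Omega s p v -> in_Lp Omega p f ->
        is_fracLapD Omega s v f ->
        \int[lebesgue_rV N]_(x in Omega) (xi x * f x) =
        \int[lebesgue_rV N]_(x in Omega) ((u x - ud x) * v x) +
        charge_integral mu Omega v,
      forall z', Zad z' ->
        0 <= \int[lebesgue_rV N]_(x in Omega)
               ((xi x + alpha * z x) * (z' x - z x)) &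
      [/\ charge_ge0 mu, forall x, Omega x -> u x <= 0 &
          charge_integral mu Omega u = 0]].

End optimality.

(* Main.v *)
Require Import Defs.
From HB Require Import structures.
From mathcomp Require Import all_boot all_order all_algebra.
From mathcomp Require Import all_classical all_reals all_analysis.
From mathcomp Require Import measurable_realfun ring lra.
Set Implicit Arguments.
Unset Strict Implicit.
Unset Printing Implicit Defensive.
Import Order.TTheory GRing.Theory Num.Theory.
Import numFieldNormedType.Exports.
Local Open Scope classical_set_scope.
Local Open Scope ring_scope.

(** The proof compares the two problems through their first-order conditions.

    Since the regularized cost is the integral over Omega of a convex
    density whose only non-quadratic term is the square of a positive part,
    minimality of (ugam, zgam) against the segment towards (ubar, zbar) gives
    a variational inequality ([reg_first_order]).  For (ubar, zbar) the
    adjoint equation, tested with v = ubar and v = ugam, turns the inequality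
    satisfied by xibar + alpha * zbar into one that no longer mentions xibar
    and in which the multiplier only appears through the integral of ugam
    against mubar ([adjoint_inequality]); complementarity removes the integral
    of ubar.  Adding the two inequalities, the quadratic terms combine into
    minus the squared errors, and what is left is the pairing of the penalty
    multiplier (muhat + gamma * ugam)_+ with ubar - ugam.  Its ubar part is
    nonpositive because ubar <= 0, and its ugam part is controlled pointwise by
    [pos_part_pairing_ge].  This is [error_estimate].  The second bound
    follows by dropping the two error terms, replacing ugam by its positive
    part under the nonnegative measure mubar, and bounding a sum by twice a
    maximum.

    Two facts about states make this argument legitimate.  The adjoint
    equation is tested with the operator (-Delta)^s_D, defined through
    truncated principal values, whereas a state is tied to its control by the
    weak equation; and convex combinations of states must again be states.
    Both follow from the integration by parts [truncated_pairing_cvg]: for u, v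
    in W^{s,2}, the integrals of v against the operator truncated at distance
    e tend to the energy of u and v.  Indeed, symmetrizing the double integral
    by Fubini turns the truncated pairing into the energy integral restricted
    to pairs of points at distance greater than e, and dominated convergence
    lets e tend to 0.  Fubini needs the kernel to be integrable away from the
    diagonal, uniformly in its centre; this is [far_kernel_le]. *)

(** * Integrable and square integrable functions *)

Section integrable_real.
Context d (T : measurableType d) (R : realType).
Variable mu : {measure set T -> \bar R}.
Implicit Types a b f g k : T -> R.

Local Notation intg f := (mu.-integrable setT (EFin \o f)).

Lemma integrable_le f g : measurable_fun setT f ->
  (forall x, `|f x| <= g x) -> intg g -> intg f.
Proof.
move=> mf fg; apply: le_integrable => //; first exact/measurable_EFinP.
by move=> x _ /=; rewrite lee_fin (le_trans (fg x)) ?ler_norm.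
Qed.

Lemma integrable_measurable f : intg f -> measurable_fun setT f.
Proof. by move=> /measurable_int/measurable_EFinP. Qed.

Lemma integrable_addr f g : intg f -> intg g -> intg (fun x => f x + g x).
Proof. by move=> If Ig; apply: eq_integrable (integrableD _ If Ig). Qed.

Lemma integrable_mull c f : intg f -> intg (fun x => c * f x).
Proof. by move=> If; apply: eq_integrable (integrableZl _ c If). Qed.

(** The weighted Cauchy-Schwarz inequality in the form |a b| <= a^2 + b^2. *)
Lemma integrable_mul_weight a b k : measurable_fun setT a ->
  measurable_fun setT b -> measurable_fun setT k -> (forall x, 0 <= k x) ->
  intg (fun x => a x ^+ 2 * k x) -> intg (fun x => b x ^+ 2 * k x) ->
  intg (fun x => a x * b x * k x).
Proof.
move=> ma mb mk k0 Ia Ib; apply: integrable_le (integrable_addr Ia Ib).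
  by apply: measurable_funM => //; exact: measurable_funM.
move=> x; rewrite -mulrDl normrM (ger0_norm (k0 x)) ler_wpM2r//.
rewrite ler_norml; apply/andP; split; have := sqr_ge0 (a x + b x);
  have := sqr_ge0 (a x - b x); have := sqr_ge0 (a x); have := sqr_ge0 (b x);
  nra.
Qed.

Lemma Lfun_measurable p f : f \in Lfun mu p -> measurable_fun setT f.
Proof. by move=> /sub_Lfun_mfun; rewrite inE. Qed.

End integrable_real.

Section swap.
Context d (T : measurableType d) (R : realType).
Variable mu : {sigma_finite_measure set T -> \bar R}.
Variable f : T * T -> R.
Hypothesis If : (mu \x mu)%E.-integrable setT (EFin \o f).

Let mfs : measurable_fun setT (EFin \o (fun z => f (z.2, z.1))).
Proof.
apply/measurable_EFinP.
exact: (measurableT_comp (integrable_measurable If) (@measurable_swap _ _ T T)).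
Qed.

Lemma integrable_swap : (mu \x mu)%E.-integrable setT (EFin \o (fun z => f (z.2, z.1))).
Proof.
apply/(integrable21ltyP mu mu mfs).
by move/(integrable12ltyP mu mu) : If; apply; exact: measurable_int If.
Qed.

Lemma Rintegral_swap :
  \int[(mu \x mu)%E]_z f (z.2, z.1) = \int[(mu \x mu)%E]_z f z.
Proof.
congr fine; rewrite -(integral12_prod_meas1 If).
by rewrite -(integral21_prod_meas1 integrable_swap).
Qed.

Lemma Rintegral_symmetrize : \int[(mu \x mu)%E]_z f z =
  2^-1 * \int[(mu \x mu)%E]_z (f z + f (z.2, z.1)).
Proof.
rewrite RintegralD//; last exact: integrable_swap.
by rewrite Rintegral_swap mulrDr mulrC -splitr.
Qed.

End swap.

Section square_integrable.
Context d (T : measurableType d) (R : realType).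
Variable mu : {measure set T -> \bar R}.
Implicit Types f g : T -> R.
Local Notation intg f := (mu.-integrable setT (EFin \o f)).

(** The real-valued form of membership in L^2, convenient because the proof
    only uses integrals of products and of squares. *)
Definition square_integrable f :=
  measurable_fun setT f /\ intg (fun x => f x ^+ 2).

Lemma Lfun2P f : f \in Lfun mu 2%:E <-> square_integrable f.
Proof.
split=> [f2|[mf If]].
  by split; [exact: Lfun_measurable f2|exact: Lfun2_integrable_sqr f2].
apply/andP; split; rewrite inE//= /finite_norm unlock poweR_lty//.
case/integrableP: If => _; rewrite (eq_integral (fun x => (`|f x| `^ 2)%:E))//.
by move=> x _ /=; rewrite normrX powR_mulrn.
Qed.

Lemma sqr_L2norm f : square_integrable f ->
  fine ('N[mu]_2%:E [EFin \o f])%E ^+ 2 = \int[mu]_x (f x ^+ 2).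
Proof.
move=> sf; have := (Lfun2P f).2 sf; case/andP => _; rewrite inE/= /finite_norm => Nf.
have N0 := Lnorm_ge0 mu 2%:E (EFin \o f).
rewrite -powR_mulrn ?fine_ge0// -fine_poweR; congr fine.
rewrite powR_Lnorm ?pnatr_eq0//; apply: eq_integral => x _ /=.
by rewrite powR_mulrn// real_normK ?num_real.
Qed.

Lemma square_integrable_mul f g : square_integrable f -> square_integrable g ->
  intg (fun x => f x * g x).
Proof.
move=> /Lfun2P sf /Lfun2P sg.
by apply/Lfun1_integrable; exact: Lfun2_mul_Lfun1.
Qed.

Lemma square_integrable_comb a b f g :
  square_integrable f -> square_integrable g ->
  square_integrable (fun x => a * f x + b * g x).
Proof.
move=> [mf If] [mg Ig].
have m : measurable_fun setT (fun x => a * f x + b * g x).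
  by apply: measurable_funD; exact: measurable_funM.
split => //.
apply: integrable_le (integrable_addr (integrable_mull (2 * a ^+ 2) If)
  (integrable_mull (2 * b ^+ 2) Ig)); first exact: measurable_funX.
move=> x; rewrite ger0_norm ?sqr_ge0//.
by have := sqr_ge0 (a * f x - b * g x); nra.
Qed.

Lemma square_integrable_sub f g :
  square_integrable f -> square_integrable g ->
  square_integrable (fun x => f x - g x).
Proof.
move=> sf sg; rewrite (_ : (fun x => _) = fun x => 1 * f x + (-1) * g x).
  exact: square_integrable_comb.
by apply/funext => x; ring.
Qed.

Lemma square_integrable_pos f :
  square_integrable f -> square_integrable f^\+.
Proof.
move=> [mf If]; have mp : measurable_fun setT f^\+.
  exact: measurable_funrpos.
split => //; apply: integrable_le If; first exact: measurable_funX.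
move=> x; rewrite ger0_norm ?sqr_ge0// /funrpos.
by case: (leP (f x) 0) => [f0|//]; rewrite expr0n sqr_ge0.
Qed.

End square_integrable.

(** * The kernel away from the diagonal *)

Section kernel.
Context {R : realType} {N : nat}.
Local Notation rV := 'rV[R]_N.
Local Notation leb := (@lebesgue_rV R N).

Lemma ler_coord_enorm (x : rV) i : `|x ord0 i| <= enorm x.
Proof.
rewrite -sqrtr_sqr /enorm ler_wsqrtr// /dotv (bigD1 i)//= -expr2 lerDl.
by apply: sumr_ge0 => j _; rewrite -expr2 sqr_ge0.
Qed.

Lemma enormC (x y : rV) : enorm (x - y) = enorm (y - x).
Proof.
rewrite /enorm /dotv; congr Num.sqrt; apply: eq_bigr => i _.
by rewrite !mxE; ring.
Qed.

Lemma measurable_box (a b : 'I_N -> R) :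
  measurable [set y : rV | forall i, y ord0 i \in `[a i, b i]].
Proof.
rewrite (_ : mkset _ = \bigcap_i [set y : rV | y ord0 i \in `[a i, b i]]).
  apply: fin_bigcap_measurable => // i _.
  have := @measurable_coord R N i measurableT _ (measurable_itv `[a i, b i]).
  by rewrite setTI.
by apply/seteqP; split=> [y yB i _|y yB i]; exact: yB.
Qed.

Lemma measurable_enormB :
  measurable_fun [set: rV * rV] (fun z => enorm (z.1 - z.2)).
Proof.
have msqrt : measurable_fun [set: R] (@Num.sqrt R).
  by apply: continuous_measurable_fun; exact: sqrt_continuous.
rewrite /enorm; apply: (measurableT_comp msqrt).
have mc i : measurable_fun [set: rV * rV] (fun z => (z.1 - z.2) ord0 i).
  under eq_fun do rewrite !mxE.
  by apply: measurable_funB; apply: (measurableT_comp (measurable_coord i)).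
by apply: measurable_sum => i; apply: measurable_funM; exact: mc.
Qed.

(** The pairs of points that the truncation at distance [e] keeps. *)
Definition far e : set (rV * rV) := [set z | e < enorm (z.1 - z.2)].

Lemma measurable_far e : measurable (far e).
Proof.
rewrite (_ : far e = (fun z : rV * rV => enorm (z.1 - z.2)) @^-1` `]e, +oo[%classic).
  by rewrite -[X in measurable X]setTI; exact: measurable_enormB.
by apply/seteqP; split => z /=; rewrite in_itv/= andbT.
Qed.

Variable s : R.
Hypothesis s_gt0 : 0 < s.

Local Notation K := (fun z : rV * rV => frac_kernel s z.1 z.2).

Let expo_gt0 : 0 < N%:R + 2 * s.
Proof. by rewrite ltr_wpDl ?mulr_gt0. Qed.

Lemma frac_kernelC (x y : rV) : frac_kernel s x y = frac_kernel s y x.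
Proof. by rewrite /frac_kernel enormC. Qed.

Lemma frac_kernel_ge0 (x y : rV) : 0 <= frac_kernel s x y.
Proof. by rewrite invr_ge0 powR_ge0. Qed.

Lemma measurable_frac_kernel : measurable_fun setT K.
Proof.
rewrite /frac_kernel; under eq_fun do rewrite -powRN.
exact: (measurableT_comp (f := @powR R ^~ (- (N%:R + 2 * s)))
  (measurable_powR _) measurable_enormB).
Qed.

(** Beyond distance e, the kernel centred at x is bounded on the shell of radii
    2^j e and 2^(j+1) e by its value at the inner radius, and that shell lies in
    a box of side 2^(j+2) e.  The products of the two are a geometric sequence
    of ratio 2^(-2s), whose sum does not depend on x. *)
Lemma far_kernel_le e : 0 < e -> exists2 C : R, 0 <= C &
  forall x, (\int[leb]_y ((\1_(far e) (x, y) : R) * frac_kernel s x y)%:E <= C%:E)%E.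
Proof.
move=> e0.
pose rad (j : nat) : R := 2 ^+ j * e.
have rad0 j : 0 < rad j by rewrite mulr_gt0// exprn_gt0.
pose box (x : rV) j : set rV := [set y | forall i,
  y ord0 i \in `[x ord0 i - rad j.+1, x ord0 i + rad j.+1]].
pose a j : R := (rad j `^ (N%:R + 2 * s))^-1.
have a0 j : 0 <= a j by rewrite invr_ge0 powR_ge0.
pose q : R := (2 `^ (2 * s))^-1.
have q0 : 0 <= q by rewrite invr_ge0 powR_ge0.
have q1 : q < 1.
  rewrite invf_lt1 ?powR_gt0//.
  have s20 : 0 < 2 * s by rewrite mulr_gt0.
  have := @gt0_ltr_powR R _ s20 1 2.
  by rewrite powR1 !nnegrE ltr1n; exact.
pose c : R := (4 * e) ^+ N / e `^ (N%:R + 2 * s).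
exists (c / (1 - q)).
  by rewrite divr_ge0 ?subr_ge0 ?(ltW q1)// divr_ge0 ?powR_ge0// exprn_ge0//
    mulr_ge0// ltW.
move=> x.
have vol j : (leb (box x j) = ((4 * e) ^+ N * (2 ^+ j) ^+ N)%:E)%E.
  rewrite /box (lebesgue_rV_box (a := fun i => x ord0 i - rad j.+1)
    (b := fun i => x ord0 i + rad j.+1)).
    congr EFin; rewrite -exprMn -[in RHS](card_ord N) -prodr_const.
    by apply: eq_bigr => i _; rewrite /rad exprS; ring.
  by move=> i; have := rad0 j.+1; lra.
have avol j : a j * ((4 * e) ^+ N * (2 ^+ j) ^+ N) = c * q ^+ j.
  rewrite /a /rad powRM ?exprn_ge0 ?(ltW e0)//.
  have -> : (2 ^+ j) `^ (N%:R + 2 * s) = (2 ^+ j) ^+ N * (q ^+ j)^-1.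
    rewrite -[2 ^+ j](@powR_mulrn _ 2)// powRAC powRD ?pnatr_eq0 ?implybT//.
    rewrite powR_mulrn ?mulr_ge0 ?powR_ge0// exprMn /q exprVn invrK.
    by rewrite !powR_mulrn// exprAC.
  rewrite /c; field.
  by rewrite !expf_neq0 ?gt_eqF ?powR_gt0//= ?invr_gt0 ?powR_gt0.
pose g j (y : rV) := (a j * \1_(box x j) y)%:E.
have g0 j y : (0 <= g j y)%E by rewrite lee_fin mulr_ge0.
have mbox j : measurable (box x j).
  exact: (measurable_box (fun i => x ord0 i - rad j.+1)).
have mg j : measurable_fun setT (g j).
  by apply/measurable_EFinP; exact: measurable_funM.
apply: (@le_trans _ _ (\int[leb]_y \sum_(j <oo) g j y)%E).
  apply: ge0_le_integral => //.
  - by move=> y _; rewrite lee_fin mulr_ge0 ?frac_kernel_ge0.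
  - apply/measurable_EFinP.
    apply: (measurableT_comp (f := fun z => \1_(far e) z * K z) _ (pair1_measurable x)).
    apply: measurable_funM; last exact: measurable_frac_kernel.
    exact: measurable_indic (measurable_far e).
  - by apply: ge0_emeasurable_sum.
  - move=> y _.
    have [xy|xy] := pselect (far e (x, y)); last first.
      by rewrite indicE memNset// mul0r; exact: nneseries_ge0.
    rewrite indicE mem_set// mul1r.
    set r := enorm (x - y).
    (* The index j of the shell with rad j <= r < rad j.+1; the minimal m is
       positive because e = rad 0 is smaller than r. *)
    have [|m mr mmin] := @ex_minnP (fun m => r < rad m).
      exists (Num.bound (r / e)); rewrite /rad -ltr_pdivrMr//.
      apply: lt_le_trans (archi_boundP _) _.
        by rewrite divr_ge0 ?sqrtr_ge0 ?ltW.
      by rewrite -natrX ler_nat ltnW// ltn_expl.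
    case: m mr mmin => [|j] rj mmin.
      by move: rj xy; rewrite /far/= /rad expr0 mul1r -/r => /lt_trans/[apply]; rewrite ltxx.
    have jr : rad j <= r.
      by rewrite leNgt; apply/negP => /mmin; rewrite ltnn.
    apply: (@le_trans _ _ (g j y)).
      rewrite /g indicE mem_set.
        rewrite mulr1 lee_fin lef_pV2 ?posrE ?powR_gt0 ?(lt_le_trans _ jr)//.
        by rewrite ge0_ler_powR ?nnegrE ?(ltW expo_gt0) ?(ltW (rad0 j)) ?sqrtr_ge0.
      move=> i; rewrite in_itv/=.
      have := le_lt_trans (ler_coord_enorm (x - y) i) rj.
      by rewrite !mxE ltr_norml => /andP[? ?]; apply/andP; split; lra.
    apply: le_trans (nneseries_lim_ge j.+1 _) => //.
    rewrite big_nat_recr//= leeDr//; exact: sume_ge0.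
rewrite integral_nneseries//.
apply: lime_le.
  by apply: is_cvg_nneseries => j _ _; apply: integral_ge0.
apply: nearW => n.
rewrite (eq_bigr (fun j => (c * q ^+ j)%:E)); last first.
  move=> j _; rewrite -avol EFinM -vol /g.
  under eq_integral do rewrite EFinM.
  by rewrite ge0_integralZl_EFin// ?integral_indic ?setIT//; exact/measurable_EFinP.
rewrite sumEFin lee_fin -mulr_sumr; apply: ler_wpM2l.
  by rewrite divr_ge0 ?powR_ge0// exprn_ge0// mulr_ge0// ltW.
have q1' : 0 < 1 - q by rewrite subr_gt0.
rewrite -[leRHS]mul1r ler_pdivlMr//.
by rewrite big_mkord mulrC -opprB mulNr -subrX1 opprB gerBl exprn_ge0.
Qed.

End kernel.

(** * From the truncated operator to the energy *)

Section truncation.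
Context {R : realType} {N : nat}.
Variable s : R.
Hypothesis s_gt0 : 0 < s.
Local Notation rV := 'rV[R]_N.
Local Notation leb := (@lebesgue_rV R N).
Local Notation leb2 := (leb \x leb)%E.
Implicit Types u v : rV -> R.

Lemma Ws2_measurable u : in_Ws2 s u -> measurable_fun setT u.
Proof. by case=> /Lfun_measurable. Qed.

Let fst_measurable u : measurable_fun setT u ->
  measurable_fun setT (fun z : rV * rV => u z.1).
Proof. by move=> mu; apply: (measurableT_comp mu). Qed.

Let snd_measurable u : measurable_fun setT u ->
  measurable_fun setT (fun z : rV * rV => u z.2).
Proof. by move=> mu; apply: (measurableT_comp mu). Qed.

Let measurable_difference u : measurable_fun setT u ->
  measurable_fun setT (fun z : rV * rV => u z.1 - u z.2).
Proof.
by move=> mu; apply: measurable_funB; [exact: fst_measurable|exact: snd_measurable].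
Qed.

Lemma Ws2_integrable u : in_Ws2 s u ->
  leb2.-integrable setT (EFin \o (fun z => (u z.1 - u z.2) ^+ 2 * frac_kernel s z.1 z.2)).
Proof.
move=> Wu; have mu := Ws2_measurable Wu; case: Wu => _ Eu.
apply/integrableP; split.
  apply/measurable_EFinP; apply: measurable_funM (measurable_frac_kernel s).
  by apply: measurable_funX; exact: measurable_difference.
rewrite (eq_integral (fun z : rV * rV =>
  ((u z.1 - u z.2) ^+ 2 * frac_kernel s z.1 z.2)%:E))// => z _ /=.
by rewrite ger0_norm// mulr_ge0//; [exact: sqr_ge0|exact: frac_kernel_ge0].
Qed.

Lemma energy_integrable u v : in_Ws2 s u -> in_Ws2 s v ->
  leb2.-integrable setT (EFin \o
    (fun z => (u z.1 - u z.2) * (v z.1 - v z.2) * frac_kernel s z.1 z.2)).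
Proof.
move=> Wu Wv; apply: integrable_mul_weight (Ws2_integrable Wu) (Ws2_integrable Wv).
- exact: measurable_difference (Ws2_measurable Wu).
- exact: measurable_difference (Ws2_measurable Wv).
- exact: measurable_frac_kernel.
- by move=> z; exact: frac_kernel_ge0.
Qed.

Definition far_kernel e (z : rV * rV) : R := \1_(far e) z * frac_kernel s z.1 z.2.

Lemma far_kernel_ge0 e z : 0 <= far_kernel e z.
Proof. by rewrite mulr_ge0 ?frac_kernel_ge0. Qed.

Lemma far_kernel_le_kernel e z : far_kernel e z <= frac_kernel s z.1 z.2.
Proof.
rewrite /far_kernel indicE ler_piMl ?frac_kernel_ge0//.
by case: (_ \in _).
Qed.

Lemma far_kernelC e x y : far_kernel e (x, y) = far_kernel e (y, x).
Proof.
rewrite /far_kernel/= frac_kernelC !indicE; congr (_%:R * _); congr nat_of_bool.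
by apply/idP/idP; rewrite !inE /far/= enormC.
Qed.

Lemma measurable_far_kernel e : measurable_fun setT (far_kernel e).
Proof.
apply: measurable_funM; last exact: measurable_frac_kernel.
exact: measurable_indic (measurable_far e).
Qed.

Lemma far_kernel_bound e z : 0 < e -> 
  far_kernel e z <= (e `^ (N%:R + 2 * s))^-1.
Proof.
move=> e0; rewrite /far_kernel indicE.
have [ez|ez] := boolP (z \in far e); last by rewrite mul0r invr_ge0 powR_ge0.
rewrite mul1r /frac_kernel; move: ez; rewrite inE/= => ez.
have ez' : 0 < enorm (z.1 - z.2) by exact: lt_trans ez.
rewrite lef_pV2 ?posrE ?powR_gt0// ge0_ler_powR ?nnegrE ?(ltW e0) ?(ltW ez) ?(ltW ez')//.
by rewrite addr_ge0// mulr_ge0// ltW.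
Qed.

Lemma far_kernel_integrable e x : 0 < e ->
  leb.-integrable setT (EFin \o (fun y => far_kernel e (x, y))).
Proof.
move=> e0; apply/integrableP; split.
  apply/measurable_EFinP.
  by apply: (measurableT_comp (measurable_far_kernel e)).
have [C _ /(_ x) xC] := @far_kernel_le _ N _ s_gt0 _ e0.
apply: (le_lt_trans _ (ltry C)); apply: le_trans xC.
rewrite (eq_integral (fun y => (far_kernel e (x, y))%:E))// => y _ /=.
by rewrite ger0_norm ?far_kernel_ge0.
Qed.

Section pair.
Variables u v : rV -> R.
Hypotheses (Wu : in_Ws2 s u) (Wv : in_Ws2 s v).
Let mu := Ws2_measurable Wu.
Let mv := Ws2_measurable Wv.

(** For every x, and not only almost every x: beyond distance e the kernel is
    both bounded, which handles the term u y, and integrable, which handles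
    u x.  Hence no null set has to be discarded when the inner integral of a
    truncated pairing is multiplied by v x. *)
Lemma truncated_difference_integrable e x : 0 < e ->
  leb.-integrable setT (EFin \o (fun y => (u x - u y) * far_kernel e (x, y))).
Proof.
move=> e0.
have mk : measurable_fun setT (fun y => far_kernel e (x, y)).
  exact: (measurableT_comp (measurable_far_kernel e)).
have Ik := far_kernel_integrable x e0.
rewrite (_ : (fun y => _) = fun y => (u x - u y) * 1 * far_kernel e (x, y)); last first.
  by apply/funext => y; rewrite mulr1.
have Iu : leb.-integrable setT (EFin \o (fun y => u y ^+ 2)).
  by case: Wu => /Lfun2_integrable_sqr.
apply: integrable_mul_weight => //.
- exact: measurable_funB.
- by move=> y; exact: far_kernel_ge0.
- have Isum := integrable_addr (integrable_mull (2 * u x ^+ 2) Ik)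
    (integrable_mull (2 * (e `^ (N%:R + 2 * s))^-1) Iu).
  apply: integrable_le Isum.
    by apply: measurable_funM => //; apply: measurable_funX; exact: measurable_funB.
  move=> y; rewrite ger0_norm; last first.
    by apply: mulr_ge0; [exact: sqr_ge0|exact: far_kernel_ge0].
  have := far_kernel_bound (x, y) e0; have := far_kernel_ge0 e (x, y).
  set k := far_kernel _ _; set b := _^-1 => k0 kb.
  apply: (@le_trans _ _ ((2 * u x ^+ 2 + 2 * u y ^+ 2) * k)).
    by rewrite ler_wpM2r//; have := sqr_ge0 (u x + u y); nra.
  by rewrite mulrDl lerD2l; have := sqr_ge0 (u y); nra.
- by under eq_fun do rewrite expr1n mul1r.
Qed.

(** By Tonelli, the uniform bound [far_kernel_le] leaves a multiple of the
    integral of v^2. *)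
Lemma far_square_integrable e : 0 < e ->
  leb2.-integrable setT (EFin \o (fun z : rV * rV => v z.1 ^+ 2 * far_kernel e z)).
Proof.
move=> e0.
have mf : measurable_fun setT (EFin \o (fun z : rV * rV => v z.1 ^+ 2 * far_kernel e z)).
  apply/measurable_EFinP; apply: measurable_funM; last exact: measurable_far_kernel.
  by apply: measurable_funX; exact: fst_measurable.
apply/(integrable12ltyP leb leb mf).
have [C C0 kC] := @far_kernel_le _ N _ s_gt0 _ e0.
have Iv : leb.-integrable setT (EFin \o (fun y => v y ^+ 2)).
  by case: Wv => /Lfun2_integrable_sqr.
have /integrableP[_] := integrable_mull C Iv; apply: le_lt_trans.
apply: ge0_le_integral => //.
- by move=> x _; apply: integral_ge0.
- apply: (measurable_fun_fubini_tonelli_F (m2 := leb)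
    (fun z => `|(v z.1 ^+ 2 * far_kernel e z)%:E|%E)).
  + by apply: measurableT_comp mf.
  + by [].
- apply/measurable_EFinP; do 2 apply: measurableT_comp => //.
  by apply: measurable_funM => //; apply: measurable_funX.
move=> x _ /=.
rewrite ger0_norm; last exact: mulr_ge0 C0 (sqr_ge0 _).
rewrite mulrC EFinM.
rewrite (eq_integral (fun y => (v x ^+ 2)%:E * (far_kernel e (x, y))%:E)%E); last first.
  move=> y _ /=.
  by rewrite ger0_norm// mulr_ge0//; [exact: sqr_ge0|exact: far_kernel_ge0].
rewrite ge0_integralZl_EFin//; last exact: sqr_ge0.
- by apply: lee_wpmul2l; [rewrite lee_fin; exact: sqr_ge0|exact: kC].
- by move=> y _; rewrite lee_fin far_kernel_ge0.
- by apply/measurable_EFinP; apply: (measurableT_comp (measurable_far_kernel e)).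
Qed.

Lemma truncated_pairing_integrable e : 0 < e ->
  leb2.-integrable setT (EFin \o
    (fun z : rV * rV => v z.1 * (u z.1 - u z.2) * far_kernel e z)).
Proof.
move=> e0; apply: integrable_mul_weight.
- exact: fst_measurable.
- exact: measurable_difference.
- exact: measurable_far_kernel.
- by move=> z; exact: far_kernel_ge0.
- exact: far_square_integrable.
- apply: integrable_le (Ws2_integrable Wu).
    apply: measurable_funM; last exact: measurable_far_kernel.
    by apply: measurable_funX; exact: measurable_difference.
  move=> z; rewrite ger0_norm; last first.
    by apply: mulr_ge0; [exact: sqr_ge0|exact: far_kernel_ge0].
  by apply: ler_wpM2l; [exact: sqr_ge0|exact: far_kernel_le_kernel].
Qed.

(** Fubini, with the factor v x moved under the inner integral. *)
Lemma truncated_pairingE e : 0 < e ->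
  \int[leb]_x (v x * fracLap_trunc s e u x) =
  @fracLap_const R N s *
    \int[leb2]_z (v z.1 * (u z.1 - u z.2) * far_kernel e z).
Proof.
move=> e0; have Ig := truncated_pairing_integrable e0.
pose F x := \int[leb]_y (v x * (u x - u y) * far_kernel e (x, y)).
have FE x : (F x)%:E = fubini_F leb (EFin \o
    (fun z : rV * rV => v z.1 * (u z.1 - u z.2) * far_kernel e z)) x.
  have IF : leb.-integrable setT (EFin \o
      (fun y => v x * (u x - u y) * far_kernel e (x, y))).
    apply: eq_integrable (integrable_mull (v x) (truncated_difference_integrable x e0)).
      exact: measurableT.
    by move=> y _ /=; rewrite mulrA.
  rewrite /F /Rintegral fineK.
    by rewrite /fubini_F.
  exact: (integrable_fin_num measurableT IF).
have -> : \int[leb2]_z (v z.1 * (u z.1 - u z.2) * far_kernel e z) = \int[leb]_x F x.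
  congr fine; rewrite -(integral12_prod_meas1 Ig).
  by apply: eq_integral => x _; rewrite -FE.
rewrite -RintegralZl//; last first.
  by have := integrable_fubini_F Ig; apply: eq_integrable => // x _; rewrite -FE.
apply: eq_Rintegral => x _; rewrite /fracLap_trunc mulrCA; congr (_ * _).
rewrite /F; under [RHS]eq_Rintegral do rewrite -mulrA.
rewrite RintegralZl; [|exact: measurableT|exact: truncated_difference_integrable].
congr (_ * _); rewrite Rintegral_mkcond; apply: eq_Rintegral => y _.
rewrite patchE /far_kernel indicE.
rewrite (_ : (y \in _) = ((x, y) \in far e)).
  by case: ifPn => _; rewrite ?mul1r// mul0r mulr0.
by apply/idP/idP; rewrite !inE.
Qed.

(** Exchanging the two points changes the sign of u x - u y and preserves the
    truncated kernel, so averaging with the exchanged integrand produces the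
    difference v x - v y. *)
Lemma truncated_pairing_symmetric e : 0 < e ->
  \int[leb]_x (v x * fracLap_trunc s e u x) =
  @fracLap_const R N s / 2 *
    \int[leb2]_z ((u z.1 - u z.2) * (v z.1 - v z.2) * far_kernel e z).
Proof.
move=> e0; rewrite truncated_pairingE// -mulrA; congr (_ * _).
apply: etrans (Rintegral_symmetrize (truncated_pairing_integrable e0)) _.
congr (_ * _); apply: eq_Rintegral => -[x y] _ /=.
by rewrite (far_kernelC e y x); ring.
Qed.

(** The truncated integrands are dominated by the energy integrand and tend to
    it at every point: on the diagonal both vanish. *)
Lemma truncated_pairing_cvg :
  \int[leb]_x (v x * fracLap_trunc s e u x) @[e --> 0^'+] --> energy s u v.
Proof.
apply/cvg_at_rightP => en [en0 ecvg].
under eq_fun do rewrite truncated_pairing_symmetric//.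
rewrite /energy; apply: cvgMl_tmp.
set w := fun z : rV * rV => (u z.1 - u z.2) * (v z.1 - v z.2).
have Iw := energy_integrable Wu Wv.
have mw : measurable_fun setT w.
  by apply: measurable_funM; exact: measurable_difference.
have mk e : measurable_fun setT (fun z => w z * far_kernel e z).
  by apply: measurable_funM => //; exact: measurable_far_kernel.
have wk_cvg z : (w z * far_kernel (en n) z)%:E @[n --> \oo] -->
    (w z * frac_kernel s z.1 z.2)%:E.
  apply: cvg_near_cst; have [z0|z0] := leP (enorm (z.1 - z.2)) 0.
    suff -> : w z = 0 by near=> n; rewrite !mul0r.
    rewrite /w (_ : z.1 = z.2) ?subrr ?mul0r//; apply/rowP => i.
    apply/eqP; rewrite -subr_eq0 -normr_le0 (le_trans _ z0)//.
    by have := ler_coord_enorm (z.1 - z.2) i; rewrite !mxE.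
  near=> n; rewrite /far_kernel indicE mem_set ?mul1r// /far/=.
  by near: n; exact: (cvgr_lt (0 : R)).
have wk_le n z : (`|(w z * far_kernel (en n) z)%:E| <=
    `|(w z * frac_kernel s z.1 z.2)%:E|)%E.
  rewrite !abse_EFin lee_fin !normrM ler_wpM2l//.
  by rewrite !ger0_norm ?far_kernel_ge0 ?far_kernel_le_kernel ?frac_kernel_ge0.
have [|||||_ _] := @dominated_convergence _ _ _ leb2 setT measurableT
  (fun n => EFin \o (fun z => w z * far_kernel (en n) z))
  (EFin \o (fun z => w z * frac_kernel s z.1 z.2))
  (fun z => `|(w z * frac_kernel s z.1 z.2)%:E|%E).
- by move=> n; apply/measurable_EFinP; exact: mk.
- exact: measurable_int Iw.
- by apply: aeW => z _; exact: wk_cvg.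
- exact: integrable_abse Iw.
- by apply: aeW => z n _; exact: wk_le.
move=> h; apply: fine_cvg; rewrite fineK//.
exact: integrable_fin_num Iw.
Unshelve. all: by end_near. Qed.

End pair.
End truncation.

(** * First-order condition of the regularized problem *)

Section quadratic.
Context {R : realType}.

(** Half the square of the positive part has a 1-Lipschitz derivative, the
    positive part itself; this is the corresponding upper Taylor bound. *)
Lemma pos_part_sqr_le (a h : R) :
  Num.max (a + h) 0 ^+ 2 <= Num.max a 0 ^+ 2 + 2 * Num.max a 0 * h + h ^+ 2.
Proof.
case: (leP a 0) => a0; case: (leP (a + h) 0) => ah; nra.
Qed.

Lemma ge0_of_linear_quadratic (A B : R) :
  (forall t, 0 <= t <= 1 -> 0 <= t * A + t ^+ 2 * B) -> 0 <= A.
Proof.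
move=> AB; rewrite leNgt; apply/negP => A0.
pose c := `|B| + 1 - A.
have B0 := normr_ge0 B.
have c0 : 0 < c by rewrite /c; lra.
(* At t = - A / c the quadratic is - (A / c)^2 (c - B), negative as c > B. *)
have t1 : 0 <= - A / c <= 1.
  rewrite ler_pdivrMr// mul1r; apply/andP; split; last by rewrite /c; lra.
  by apply: divr_ge0; lra.
have := AB _ t1.
rewrite (_ : _ + _ = - (A ^+ 2 / c ^+ 2) * (c - B)); last first.
  by field; rewrite gt_eqF.
rewrite mulNr oppr_ge0 leNgt => /negP; apply.
have := ler_norm B => BB; apply: mulr_gt0; last by rewrite /c; lra.
by rewrite -expr_div_n exprn_even_gt0//= mulf_neq0 ?invr_eq0 ?(lt_eqF A0) ?(gt_eqF c0).
Qed.

End quadratic.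

Section variational.
Context d (T : measurableType d) (R : realType).
Variable mu : {measure set T -> \bar R}.
Local Notation intg f := (mu.-integrable setT (EFin \o f)).
Variables alpha gamma : R.
Hypothesis gamma_gt0 : 0 < gamma.

(** The integrand of the regularized cost, as a function of the values of the
    data ud and m (the shift muhat), of the state and of the control. *)
Definition reg_density (ud m u z : R) : R :=
  2^-1 * (u - ud) ^+ 2 + alpha / 2 * z ^+ 2 +
  (2 * gamma)^-1 * Num.max (m + gamma * u) 0 ^+ 2.

(** The derivative of [reg_density] in the direction (du, dz). *)
Definition reg_slope (ud m u z du dz : R) : R :=
  (u - ud) * du + alpha * (z * dz) + Num.max (m + gamma * u) 0 * du.

Lemma reg_density_le ud m u z du dz t :
  reg_density ud m (u + t * du) (z + t * dz) <=
  reg_density ud m u z + t * reg_slope ud m u z du dz +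
  t ^+ 2 * ((1 + gamma) / 2 * du ^+ 2 + alpha / 2 * dz ^+ 2).
Proof.
have := pos_part_sqr_le (m + gamma * u) (gamma * (t * du)).
rewrite -addrA -mulrDr /reg_density /reg_slope.
set P := Num.max _ _; set Q := Num.max _ _ => PQ.
apply: (@le_trans _ _ (2^-1 * (u + t * du - ud) ^+ 2 +
    alpha / 2 * (z + t * dz) ^+ 2 + (2 * gamma)^-1 *
    (Q ^+ 2 + 2 * Q * (gamma * (t * du)) + (gamma * (t * du)) ^+ 2))).
  by rewrite lerD2l ler_pM2l// invr_gt0 mulr_gt0.
by rewrite le_eqVlt; apply/orP; left; apply/eqP; field; rewrite gt_eqF.
Qed.

Variables ud m u z du dz : T -> R.
Hypotheses (sud : square_integrable mu ud) (sm : square_integrable mu m).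
Hypotheses (su : square_integrable mu u) (sz : square_integrable mu z).
Hypotheses (sdu : square_integrable mu du) (sdz : square_integrable mu dz).

Lemma reg_density_integrable (u' z' : T -> R) :
  square_integrable mu u' -> square_integrable mu z' ->
  intg (fun x => reg_density (ud x) (m x) (u' x) (z' x)).
Proof.
move=> su' sz'; apply: integrable_addr; first apply: integrable_addr.
- by apply: integrable_mull; have [] := square_integrable_sub su' sud.
- by apply: integrable_mull; case: sz'.
- apply: integrable_mull.
  have := square_integrable_pos (square_integrable_comb 1 gamma sm su').
  by case=> _; under eq_fun do rewrite /funrpos mul1r.
Qed.

Lemma reg_slope_integrable :
  intg (fun x => reg_slope (ud x) (m x) (u x) (z x) (du x) (dz x)).
Proof.
apply: integrable_addr; first apply: integrable_addr.
- exact: square_integrable_mul (square_integrable_sub su sud) sdu.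
- by apply: integrable_mull; exact: square_integrable_mul.
- have := square_integrable_pos (square_integrable_comb 1 gamma sm su).
  move=> /square_integrable_mul /(_ sdu).
  by under [X in intg X -> _]eq_fun do rewrite /funrpos mul1r.
Qed.

(** The increment of the cost over a step t is at most t times the integral
    of the slope plus a multiple of t^2, so the integral of the slope cannot be
    negative. *)
Lemma reg_first_order :
  (forall t, 0 <= t <= 1 ->
    \int[mu]_x reg_density (ud x) (m x) (u x) (z x) <=
    \int[mu]_x reg_density (ud x) (m x) (u x + t * du x) (z x + t * dz x)) ->
  0 <= \int[mu]_x reg_slope (ud x) (m x) (u x) (z x) (du x) (dz x).
Proof.
move=> Jle.
pose b x := (1 + gamma) / 2 * du x ^+ 2 + alpha / 2 * dz x ^+ 2.
have Ib : intg b.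
  by apply: integrable_addr; apply: integrable_mull; [case: sdu|case: sdz].
have IJ := reg_density_integrable su sz.
have Is := reg_slope_integrable.
apply: (@ge0_of_linear_quadratic _ _ (\int[mu]_x b x)) => t t01.
have := Jle t t01; rewrite -subr_ge0 => /le_trans; apply.
rewrite lerBlDr addrC.
have Ist := integrable_mull t Is; have Ibt := integrable_mull (t ^+ 2) Ib.
rewrite -!RintegralZl// -RintegralD// -RintegralD//; last exact: integrable_addr.
apply: le_Rintegral => //.
- apply: reg_density_integrable.
  + by have := square_integrable_comb 1 t su sdu; under eq_fun do rewrite mul1r.
  + by have := square_integrable_comb 1 t sz sdz; under eq_fun do rewrite mul1r.
- by apply: integrable_addr => //; exact: integrable_addr.
by move=> x _; rewrite [leRHS]addrA; exact: reg_density_le.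
Qed.

End variational.

(** * The error estimate in an abstract measure space *)

Section estimate.
Context d (T : measurableType d) (R : realType).
Variable mu : {measure set T -> \bar R}.
Local Notation intg f := (mu.-integrable setT (EFin \o f)).
Variables alpha gamma : R.
Hypothesis gamma_gt0 : 0 < gamma.

Lemma cancel_nonneg (S A L M c : R) :
  0 <= S -> 0 <= c + A -> 0 <= M + - 1 * (L + (S + A)) -> L <= M + c.
Proof. by lra. Qed.

Lemma Rintegral_ge0_ae (f : T -> R) : intg f ->
  {ae mu, forall x, 0 <= f x} -> 0 <= \int[mu]_x f x.
Proof.
move=> If f0; rewrite (_ : \int[mu]_x f x = \int[mu]_x `|f x|).
  exact: Rintegral_ge0.
congr fine; apply: ae_eq_integral => //.
- exact: measurable_int If.
- by apply/measurable_EFinP; apply: measurableT_comp => //; exact: integrable_measurable If.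
- by move: f0; apply: filterS => x f0 _; rewrite ger0_norm.
Qed.

(** For u >= 0 the pairing is at least gamma u^2 because m >= 0.  For u < 0 it
    can only be negative when m > gamma |u|, and then the left side is 0 while
    m^2 / gamma + (m + gamma u) u is a positive definite quadratic form in m
    and gamma u, divided by gamma. *)
Lemma pos_part_pairing_ge (m u : R) : 0 <= m ->
  gamma * Num.max u 0 ^+ 2 <=
  gamma^-1 * m ^+ 2 + Num.max (m + gamma * u) 0 * u.
Proof.
move=> m0; have g0 := gamma_gt0.
have gm : 0 <= gamma^-1 * m ^+ 2 by rewrite mulr_ge0 ?invr_ge0 ?(ltW g0) ?sqr_ge0.
case: (leP u 0) => u0.
  rewrite expr0n/= mulr0; case: (leP (m + gamma * u) 0) => mu0; first by rewrite mul0r addr0.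
  rewrite (_ : _ + _ = gamma^-1 * (m ^+ 2 + m * (gamma * u) + (gamma * u) ^+ 2)).
    apply: mulr_ge0; first by rewrite invr_ge0 ltW.
    by have := sqr_ge0 (m + gamma * u); have := sqr_ge0 (m - gamma * u); have := sqr_ge0 m; nra.
  by field; rewrite gt_eqF.
case: (leP (m + gamma * u) 0) => mu0.
  by have := mulr_gt0 g0 u0; lra.
by have := mulr_ge0 m0 (ltW u0); nra.
Qed.

Variables ud m ug zg ub zb : T -> R.
Hypotheses (sud : square_integrable mu ud) (sm : square_integrable mu m).
Hypotheses (sug : square_integrable mu ug) (szg : square_integrable mu zg).
Hypotheses (sub : square_integrable mu ub) (szb : square_integrable mu zb).

(** Here c stands for the integral of ug against the multiplier of the state
    constraint.  The two integrands of the hypotheses add up to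
    -(ub - ug)^2 - alpha (zb - zg)^2 + (m + gamma ug)_+ (ub - ug). *)
Lemma error_estimate (c : R) :
  {ae mu, forall x, 0 <= m x} -> (forall x, ub x <= 0) ->
  0 <= \int[mu]_x reg_slope alpha gamma (ud x) (m x) (ug x) (zg x)
                    (ub x - ug x) (zb x - zg x) ->
  0 <= c + \int[mu]_x ((ub x - ud x) * (ug x - ub x) +
                       alpha * (zb x * (zg x - zb x))) ->
  alpha * \int[mu]_x ((zb x - zg x) ^+ 2) + \int[mu]_x ((ub x - ug x) ^+ 2) +
  gamma * \int[mu]_x (ug^\+ x ^+ 2) <=
  gamma^-1 * \int[mu]_x (m x ^+ 2) + c.
Proof.
move=> m0 ub0 slope0 adj0.
have [_ Iz] := square_integrable_sub szb szg.
have [_ Iu] := square_integrable_sub sub sug.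
have [_ Ip] := square_integrable_pos sug.
have [_ Im] := sm.
have Is := reg_slope_integrable alpha gamma sud sm sug szg
  (square_integrable_sub sub sug) (square_integrable_sub szb szg).
have Ia := integrable_addr
  (square_integrable_mul (square_integrable_sub sub sud) (square_integrable_sub sug sub))
  (integrable_mull alpha (square_integrable_mul szb (square_integrable_sub szg szb))).
have IL := integrable_addr (integrable_addr (integrable_mull alpha Iz) Iu)
  (integrable_mull gamma Ip).
have IR := integrable_mull gamma^-1 Im.
have IS := integrable_addr Is Ia.
have ID := integrable_addr IR (integrable_mull (-1) (integrable_addr IL IS)).
have D0 := Rintegral_ge0_ae ID.
have : 0 <= gamma^-1 * \int[mu]_x (m x ^+ 2) + - 1 *
   ((alpha * \int[mu]_x ((zb x - zg x) ^+ 2) + \int[mu]_x ((ub x - ug x) ^+ 2) +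
     gamma * \int[mu]_x (ug^\+ x ^+ 2)) +
    (\int[mu]_x reg_slope alpha gamma (ud x) (m x) (ug x) (zg x)
                    (ub x - ug x) (zb x - zg x) +
     \int[mu]_x ((ub x - ud x) * (ug x - ub x) +
                       alpha * (zb x * (zg x - zb x))))).
  rewrite -(RintegralD measurableT Is Ia) -(RintegralZl alpha measurableT Iz).
  rewrite -(RintegralZl gamma measurableT Ip).
  rewrite -(RintegralD measurableT (integrable_mull alpha Iz) Iu).
  rewrite -(RintegralD measurableT (integrable_addr (integrable_mull alpha Iz) Iu)
              (integrable_mull gamma Ip)).
  rewrite -(RintegralD measurableT IL IS).
  rewrite -(RintegralZl (-1) measurableT (integrable_addr IL IS)).
  rewrite -(RintegralZl gamma^-1 measurableT Im).
  rewrite -(RintegralD measurableT IR (integrable_mull (-1) (integrable_addr IL IS))).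
  apply: D0; move: m0; apply: filterS => x mx0.
  have := pos_part_pairing_ge (ug x) mx0.
  rewrite /reg_slope /funrpos; set P := Num.max _ _; set Q := Num.max _ _ => PQ.
  have : 0 <= Q * - ub x by rewrite mulr_ge0 ?oppr_ge0// /Q le_max lexx orbT.
  by nra.
exact: cancel_nonneg slope0 adj0.
Qed.

End estimate.

(** * Lebesgue spaces on a bounded open set *)

Section domain.
Context {R : realType} {N : nat}.
Local Notation rV := 'rV[R]_N.
Local Notation leb := (@lebesgue_rV R N).
Implicit Types (Omega : set rV) (f g u v z : rV -> R).

Lemma ler_coord_norm (x : rV) i : `|x ord0 i| <= `|x|.
Proof.
rewrite [leRHS]/Num.norm/= mx_normrE; apply/bigmax_geP; right => /=.
by exists (ord0, i).
Qed.

Lemma bounded_setP Omega : bounded_set Omega ->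
  exists2 M : R, 0 <= M & forall x, Omega x -> `|x| <= M.
Proof.
move=> [M [_ OM]]; exists (`|M| + 1) => [|x Ox]; first by rewrite addr_ge0.
by apply: OM Ox; rewrite (le_lt_trans (ler_norm M))// ltrDl.
Qed.

Lemma bounded_lebesgue_lty Omega : measurable Omega -> bounded_set Omega ->
  (leb Omega < +oo)%E.
Proof.
move=> mO /bounded_setP[M M0 OM].
pose box : set rV := [set x | forall i, x ord0 i \in `[- M, M]].
have mbox : measurable box by exact: (measurable_box (fun=> - M)).
apply: (@le_lt_trans _ _ (leb box)).
  rewrite le_measure ?inE// => x /OM xM i.
  by rewrite in_itv/= -ler_norml (le_trans (ler_coord_norm x i)).
rewrite /box (lebesgue_rV_box (a := fun=> - M) (b := fun=> M)) ?ltry// => _.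
by rewrite ge0_cp.
Qed.

Lemma in_Lp2P Omega f : in_Lp Omega 2 f <-> square_integrable leb (f \_ Omega).
Proof. exact: Lfun2P. Qed.

(** On a set of finite measure, f^2 <= 1 + |f|^p. *)
Lemma in_Lp_in_L2 Omega p f : measurable Omega -> bounded_set Omega -> 2 <= p ->
  in_Lp Omega p f -> in_Lp Omega 2 f.
Proof.
move=> mO bO p2 Lf; apply/in_Lp2P; have mf := Lfun_measurable Lf; split => //.
have p1 : 1 <= p by rewrite (le_trans _ p2)// ler1n.
have If := Lfun_integrable p1 Lf.
have I1 : leb.-integrable setT (EFin \o (\1_Omega : rV -> R)).
  apply/integrableP; split; first by apply/measurable_EFinP.
  rewrite (eq_integral (fun x => (\1_Omega x)%:E)); last first.
    by move=> x _; rewrite /= ger0_norm.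
  by rewrite integral_indic// setIT; exact: bounded_lebesgue_lty.
apply: integrable_le (integrable_addr I1 If); first exact: measurable_funX.
move=> x; rewrite ger0_norm ?sqr_ge0// indicE patchE.
case: ifPn => xO; last by rewrite expr0n/= addr_ge0// powR_ge0.
have [f1|f1] := leP `|f x| 1.
  rewrite -real_normK ?num_real// (@le_trans _ _ 1) ?exprn_ile1//.
  by rewrite lerDl powR_ge0.
rewrite -real_normK ?num_real// -powR_mulrn// (@le_trans _ _ (`|f x| `^ p))//.
  by rewrite ler_powR// ltW.
by rewrite lerDr.
Qed.

Lemma Rintegral_mul_restrict Omega f g :
  \int[leb]_(x in Omega) (f x * g x) =
  \int[leb]_x ((f \_ Omega) x * (g \_ Omega) x).
Proof.
rewrite Rintegral_mkcond; apply: eq_Rintegral => x _.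
by rewrite !patchE; case: ifPn; rewrite ?mul0r.
Qed.

Lemma L2norm_sqr Omega f : in_Lp Omega 2 f ->
  L2norm Omega f ^+ 2 = \int[leb]_x ((f \_ Omega) x ^+ 2).
Proof. by move=> /in_Lp2P; exact: sqr_L2norm. Qed.

Lemma conjugate_Lp_integrable Omega p f g : 1 < p ->
  in_Lp Omega (p / (p - 1)) f -> in_Lp Omega p g ->
  leb.-integrable setT (EFin \o (fun x => (f \_ Omega) x * (g \_ Omega) x)).
Proof.
move=> p1 Lf Lg; have p0 : 0 < p by rewrite (lt_trans _ p1).
have mf := Lfun_measurable Lf; have mg := Lfun_measurable Lg.
apply/Lfun1_integrable; apply/andP; split.
  by rewrite inE/=; exact: measurable_funM.
rewrite inE/= /finite_norm; apply: le_lt_trans.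
  apply: (@hoelder _ _ _ _ _ _ (p / (p - 1)) p) => //.
    by rewrite divr_gt0// subr_gt0.
  by rewrite invf_div; field; rewrite gt_eqF.
rewrite lte_mul_pinfty ?Lnorm_ge0// ?ge0_fin_numE ?Lnorm_ge0//.
- by move: Lf => /andP[_]; rewrite inE.
- by move: Lg => /andP[_]; rewrite inE.
Qed.

End domain.

(** * Linearity of the state equation *)

Section states.
Context {R : realType} {N : nat}.
Local Notation rV := 'rV[R]_N.
Local Notation leb := (@lebesgue_rV R N).
Local Notation leb2 := (leb \x leb)%E.
Variables (Omega : set rV) (s p : R).
Hypotheses (s_gt0 : 0 < s) (p_ge2 : 2 <= p).
Hypotheses (oO : open Omega) (bO : bounded_set Omega).
Implicit Types (f g u v z : rV -> R).

Let mO : measurable Omega. Proof. exact: open_measurable_rV. Qed.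

(** The seminorm of a combination expands into the two seminorms and the
    energy of u and v, all of which are finite. *)
Lemma Ws2_comb a b u v : in_Ws2 s u -> in_Ws2 s v ->
  in_Ws2 s (fun x => a * u x + b * v x).
Proof.
move=> Wu Wv; split.
  apply/Lfun2P; apply: square_integrable_comb; apply/Lfun2P.
  - by case: Wu.
  - by case: Wv.
have Iu := Ws2_integrable Wu; have Iv := Ws2_integrable Wv.
have Iuv := energy_integrable Wu Wv.
have I := integrable_addr (integrable_addr (integrable_mull (a ^+ 2) Iu)
  (integrable_mull (b ^+ 2) Iv)) (integrable_mull (2 * a * b) Iuv).
have := integrable_lty measurableT I; apply: le_lt_trans.
rewrite le_eqVlt; apply/orP; left; apply/eqP; apply: eq_integral => z _ /=.
by congr EFin; ring.
Qed.

Lemma Ws20_comb a b u v : in_Ws20 Omega s u -> in_Ws20 Omega s v ->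
  in_Ws20 Omega s (fun x => a * u x + b * v x).
Proof.
move=> [Wu u0] [Wv v0]; split; first exact: Ws2_comb.
by move: u0 v0; apply: filterS2 => x xu xv Ox; rewrite xu// xv// !mulr0 addr0.
Qed.

Lemma C0_comb a b u v : in_C0 Omega u -> in_C0 Omega v ->
  in_C0 Omega (fun x => a * u x + b * v x).
Proof.
move=> [cu u0] [cv v0]; split.
  by move=> x; apply: cvgD; apply: cvgMl_tmp; [exact: cu|exact: cv].
by move=> x bx; rewrite u0// v0// !mulr0 addr0.
Qed.

Lemma energy_comb a b u1 u2 v : in_Ws2 s u1 -> in_Ws2 s u2 -> in_Ws2 s v ->
  energy s (fun x => a * u1 x + b * u2 x) v = a * energy s u1 v + b * energy s u2 v.
Proof.
move=> W1 W2 Wv.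
have I1 := energy_integrable W1 Wv; have I2 := energy_integrable W2 Wv.
rewrite /energy.
have -> : \int[leb2]_z ((a * u1 z.1 + b * u2 z.1 - (a * u1 z.2 + b * u2 z.2)) *
     (v z.1 - v z.2) * frac_kernel s z.1 z.2) =
   a * \int[leb2]_z ((u1 z.1 - u1 z.2) * (v z.1 - v z.2) * frac_kernel s z.1 z.2) +
   b * \int[leb2]_z ((u2 z.1 - u2 z.2) * (v z.1 - v z.2) * frac_kernel s z.1 z.2).
  rewrite -(RintegralZl a measurableT I1) -(RintegralZl b measurableT I2).
  rewrite -(RintegralD measurableT (integrable_mull a I1) (integrable_mull b I2)).
  by apply: eq_Rintegral => z _; ring.
by ring.
Qed.

Lemma Ws20_restrict v : in_Ws20 Omega s v -> square_integrable leb (v \_ Omega).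
Proof.
move=> [[/Lfun2P[mv Iv] _] _].
have mvO : measurable_fun setT (v \_ Omega).
  by apply/(measurable_restrictT _ mO); exact: measurable_funTS.
split => //; apply: integrable_le Iv; first exact: measurable_funX.
move=> x; rewrite ger0_norm ?sqr_ge0// patchE.
by case: ifPn => // _; rewrite expr0n sqr_ge0.
Qed.

(** The distribution that the truncated operators of u converge to is given by
    the energy, and the weak equation identifies it with z. *)
Lemma state_fracLapD z u : in_Lp Omega p z -> is_state Omega s p z u ->
  is_fracLapD Omega s u z.
Proof.
move=> Lz [[Wu _ _] uz]; split => //; first exact: in_Lp_in_L2 Lz.
move=> v Wv; rewrite -uz//.
by apply: truncated_pairing_cvg => //; [case: Wu|case: Wv].
Qed.

(** The weak equation is linear, and it implies the equation for (-Delta)^s_D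
    that membership in U requires. *)
Lemma state_comb a b z1 z2 u1 u2 :
  in_Lp Omega p z1 -> in_Lp Omega p z2 ->
  in_Lp Omega p (fun x => a * z1 x + b * z2 x) ->
  is_state Omega s p z1 u1 -> is_state Omega s p z2 u2 ->
  is_state Omega s p (fun x => a * z1 x + b * z2 x) (fun x => a * u1 x + b * u2 x).
Proof.
move=> L1 L2 L12 [[W1 C1 _] E1] [[W2 C2 _] E2].
have W := Ws20_comb a b W1 W2.
have weak v : in_Ws20 Omega s v ->
    energy s (fun x => a * u1 x + b * u2 x) v =
    \int[leb]_(x in Omega) ((a * z1 x + b * z2 x) * v x).
  move=> Wv; rewrite energy_comb; [|by case: W1|by case: W2|by case: Wv].
  rewrite (E1 _ Wv) (E2 _ Wv) !(Rintegral_mul_restrict Omega).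
  have sv := Ws20_restrict Wv.
  have I1 := square_integrable_mul ((in_Lp2P _ _).1 (in_Lp_in_L2 mO bO p_ge2 L1)) sv.
  have I2 := square_integrable_mul ((in_Lp2P _ _).1 (in_Lp_in_L2 mO bO p_ge2 L2)) sv.
  rewrite -(RintegralZl a measurableT I1) -(RintegralZl b measurableT I2).
  rewrite -(RintegralD measurableT (integrable_mull a I1) (integrable_mull b I2)).
  apply: eq_Rintegral => x _; rewrite !patchE; case: ifPn => _.
    by ring.
  by rewrite !mulr0 addr0.
split => //; split => //; first exact: C0_comb.
exists (fun x => a * z1 x + b * z2 x) => //; split => //.
  exact: in_Lp_in_L2 L12.
move=> v Wv; rewrite -weak//.
by apply: truncated_pairing_cvg => //; [case: W|case: Wv].
Qed.

End states.

(** * Integration against a nonnegative charge *)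

Section charges.
Context {R : realType} {N : nat}.
Local Notation rV := 'rV[R]_N.
Variable mu : {charge set rV -> \bar R}.
Hypothesis mu0 : charge_ge0 mu.

(** A nonnegative charge vanishes on every measurable subset of its negative
    Hahn set, so its negative Jordan part is the zero measure. *)
Lemma charge_integral_ge0E (D : set rV) : measurable D ->
  exists nu : {finite_measure set rV -> \bar R},
    forall v, charge_integral mu D v = \int[nu]_(x in D) v x.
Proof.
move=> mD; rewrite /charge_integral.
set P := cid (Hahn_decomposition mu); set Q := cid (projT2 P).
exists (jordan_pos (projT2 Q)) => v.
suff -> : \int[jordan_neg (projT2 Q)]_(x in D) v x = 0 by rewrite subr0.
rewrite /Rintegral (eq_measure_integral mzero) ?integral_measure_zero//.
move=> A mA AD; apply/eqP; rewrite eq_le measure_ge0 andbT.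
rewrite [leLHS](cjordan_negE (projT2 Q) A) oppe_le0 /crestr0 mem_set//.
by apply: mu0; apply: measurableI => //; case: (projT2 Q) => _ [].
Qed.

(** The closure of a bounded set is compact, so u is bounded on it. *)
Lemma C0_measure_integrable (nu : {finite_measure set rV -> \bar R}) Omega u :
  measurable_fun setT u -> open Omega -> bounded_set Omega ->
  in_C0 Omega u -> nu.-integrable Omega (EFin \o u).
Proof.
move=> mu_ oO bO [cu _].
have mO := open_measurable_rV oO.
have cptO : compact (closure Omega).
  apply: bounded_closed_compact; last exact: closed_closure.
  have [M M0 OM] := bounded_setP bO.
  have clM : closed [set x : rV | `|x| <= M].
    apply: (@closed_comp _ _ (fun x : rV => `|x|) [set r | r <= M]).
      by move=> x _; exact: norm_continuous.
    exact: closed_le.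
  exists M; split; first exact: num_real.
  move=> r Mr x Ox; apply: le_trans (ltW Mr).
  by apply: clM; exact: (closureS OM Ox).
have [M [_ uM]] := compact_bounded (continuous_compact cu cptO).
apply: measurable_bounded_integrable => //.
- by rewrite -ge0_fin_numE// fin_num_measure.
- exact: measurable_funTS.
- exists M; split; first exact: num_real.
  move=> r Mr y Oy; apply: (uM r Mr); exists y => //; exact: subset_closure.
Qed.

End charges.

(** * Costs and adjoint equation on the domain *)

Section cost.
Context {R : realType} {N : nat}.
Local Notation rV := 'rV[R]_N.
Local Notation leb := (@lebesgue_rV R N).
Variables (Omega : set rV) (alpha gamma : R) (ud muhat : rV -> R).
Hypothesis mO : measurable Omega.
Hypotheses (Lud : in_Lp Omega 2 ud) (Lm : in_Lp Omega 2 muhat).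

Lemma restrict_sub (f g : rV -> R) :
  (f \- g) \_ Omega = fun x => (f \_ Omega) x - (g \_ Omega) x.
Proof. by apply/funext => x; rewrite !patchE; case: ifPn; rewrite ?subrr. Qed.

Lemma L2norm_sub_sqr (f g : rV -> R) : in_Lp Omega 2 f -> in_Lp Omega 2 g ->
  L2norm Omega (f \- g) ^+ 2 = \int[leb]_x (((f \_ Omega) x - (g \_ Omega) x) ^+ 2).
Proof.
move=> /in_Lp2P sf /in_Lp2P sg; rewrite L2norm_sqr.
  by rewrite restrict_sub.
by apply/in_Lp2P; rewrite restrict_sub; exact: square_integrable_sub.
Qed.

Lemma reg_costE (u z : rV -> R) : in_Lp Omega 2 u -> in_Lp Omega 2 z ->
  reg_cost Omega alpha gamma ud muhat u z =
  \int[leb]_x reg_density alpha gamma ((ud \_ Omega) x) ((muhat \_ Omega) x)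
                ((u \_ Omega) x) ((z \_ Omega) x).
Proof.
move=> Lu Lz.
have [sud su sz sm] : [/\ square_integrable leb (ud \_ Omega),
    square_integrable leb (u \_ Omega), square_integrable leb (z \_ Omega) &
    square_integrable leb (muhat \_ Omega)] by split; apply/in_Lp2P.
have [_ I1] := square_integrable_sub su sud.
have [_ I2] := sz.
have sP := square_integrable_pos (square_integrable_comb 1 gamma sm su).
have [_ I3] := sP.
have rE : (fun x => muhat x + gamma * u x)^\+ \_ Omega =
    (fun x => 1 * (muhat \_ Omega) x + gamma * (u \_ Omega) x)^\+.
  apply/funext => x; rewrite /funrpos !patchE; case: ifPn; rewrite ?mul1r//.
  by rewrite !mulr0 addr0 maxxx.
rewrite /reg_cost /cost L2norm_sub_sqr// (L2norm_sqr Lz) L2norm_sqr; last first.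
  by apply/in_Lp2P; rewrite rE.
rewrite rE.
rewrite -(RintegralZl _ measurableT I1) -(RintegralZl _ measurableT I2).
rewrite -(RintegralZl _ measurableT I3).
rewrite -(RintegralD measurableT (integrable_mull _ I1) (integrable_mull _ I2)).
rewrite -(RintegralD measurableT (integrable_addr (integrable_mull _ I1)
  (integrable_mull _ I2)) (integrable_mull _ I3)).
by apply: eq_Rintegral => x _; rewrite /reg_density /funrpos mul1r.
Qed.

End cost.

Section adjoint.
Context {R : realType} {N : nat}.
Local Notation rV := 'rV[R]_N.
Local Notation leb := (@lebesgue_rV R N).
Variables (Omega : set rV) (p alpha c : R) (ud ub ug zb zg xi : rV -> R).
Hypotheses (mO : measurable Omega) (bO : bounded_set Omega) (p_ge2 : 2 <= p).
Hypotheses (Lud : in_Lp Omega 2 ud) (Lub : in_Lp Omega 2 ub).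
Hypotheses (Lug : in_Lp Omega 2 ug).
Hypotheses (Lzb : in_Lp Omega p zb) (Lzg : in_Lp Omega p zg).
Hypothesis Lxi : in_Lp Omega (p / (p - 1)) xi.

(** Subtracting the two adjoint equations expresses the pairing of xi with
    zg - zb through ub, ud and c; substituting it in the variational inequality
    eliminates xi.  Here c stands for the integral of ug against the multiplier
    of the state constraint. *)
Lemma adjoint_inequality :
  \int[leb]_(x in Omega) (xi x * zb x) =
  \int[leb]_(x in Omega) ((ub x - ud x) * ub x) ->
  \int[leb]_(x in Omega) (xi x * zg x) =
  \int[leb]_(x in Omega) ((ub x - ud x) * ug x) + c ->
  0 <= \int[leb]_(x in Omega) ((xi x + alpha * zb x) * (zg x - zb x)) ->
  0 <= c + \int[leb]_x
    (((ub \_ Omega) x - (ud \_ Omega) x) * ((ug \_ Omega) x - (ub \_ Omega) x) +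
     alpha * ((zb \_ Omega) x * ((zg \_ Omega) x - (zb \_ Omega) x))).
Proof.
have p1 : 1 < p by rewrite (lt_le_trans _ p_ge2)// ltr1n.
have /in_Lp2P sud := Lud; have /in_Lp2P sub := Lub; have /in_Lp2P sug := Lug.
have /in_Lp2P szb := in_Lp_in_L2 mO bO p_ge2 Lzb.
have /in_Lp2P szg := in_Lp_in_L2 mO bO p_ge2 Lzg.
have Ixb := conjugate_Lp_integrable p1 Lxi Lzb.
have Ixg := conjugate_Lp_integrable p1 Lxi Lzg.
have sr := square_integrable_sub sub sud.
have Irb := square_integrable_mul sr sub.
have Irg := square_integrable_mul sr sug.
have Iz := square_integrable_mul szb (square_integrable_sub szg szb).
have rE (v : rV -> R) : \int[leb]_(x in Omega) ((ub x - ud x) * v x) =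
    \int[leb]_x (((ub \_ Omega) x - (ud \_ Omega) x) * (v \_ Omega) x).
  rewrite Rintegral_mkcond; apply: eq_Rintegral => x _; rewrite !patchE.
  by case: ifPn => //; rewrite mulr0.
rewrite !rE !(Rintegral_mul_restrict Omega xi) => Eb Eg.
have -> : \int[leb]_(x in Omega) ((xi x + alpha * zb x) * (zg x - zb x)) =
    \int[leb]_x ((xi \_ Omega) x * (zg \_ Omega) x) -
    \int[leb]_x ((xi \_ Omega) x * (zb \_ Omega) x) +
    alpha * \int[leb]_x ((zb \_ Omega) x * ((zg \_ Omega) x - (zb \_ Omega) x)).
  rewrite -(RintegralB measurableT Ixg Ixb) -(RintegralZl _ measurableT Iz).
  rewrite -(RintegralD measurableT (integrableB measurableT Ixg Ixb) (integrable_mull alpha Iz)).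
  rewrite Rintegral_mkcond; apply: eq_Rintegral => x _; rewrite !patchE.
  by case: ifPn => _; [ring|rewrite !mul0r mulr0 subrr addr0].
have -> : \int[leb]_x
    (((ub \_ Omega) x - (ud \_ Omega) x) * ((ug \_ Omega) x - (ub \_ Omega) x) +
     alpha * ((zb \_ Omega) x * ((zg \_ Omega) x - (zb \_ Omega) x))) =
    \int[leb]_x (((ub \_ Omega) x - (ud \_ Omega) x) * (ug \_ Omega) x) -
    \int[leb]_x (((ub \_ Omega) x - (ud \_ Omega) x) * (ub \_ Omega) x) +
    alpha * \int[leb]_x ((zb \_ Omega) x * ((zg \_ Omega) x - (zb \_ Omega) x)).
  rewrite -(RintegralB measurableT Irg Irb) -(RintegralZl _ measurableT Iz).
  rewrite -(RintegralD measurableT (integrableB measurableT Irg Irb) (integrable_mull alpha Iz)).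
  by apply: eq_Rintegral => x _; ring.
rewrite Eb Eg => /le_trans; apply; rewrite le_eqVlt; apply/orP; left; apply/eqP.
by rewrite addrA [in RHS]addrA (addrC c) addrAC.
Qed.

End adjoint.

(** * The two bounds *)

Theorem theorem4p1 (R : realType) (N : nat) (Omega : set 'rV[R]_N)
    (s p alpha gamma : R) (ud muhat : 'rV[R]_N -> R)
    (Zad : set ('rV[R]_N -> R))
    (ubar zbar xibar ugam zgam : 'rV[R]_N -> R)
    (mubar : {charge set 'rV[R]_N -> \bar R}) :
  (1 <= N)%N ->
  bounded_lipschitz_domain Omega ->
  exterior_cone_condition Omega ->
  0 < s < 1 ->
  0 < alpha ->
  2 <= p ->
  N%:R / (2 * s) < p ->
  in_Lp Omega 2 ud ->
  admissible_controls Omega p Zad ->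
  in_Lp Omega 2 muhat ->
  {ae lebesgue_rV N, forall x, Omega x -> 0 <= muhat x} ->
  0 < gamma ->
  is_solution Omega s p alpha ud Zad ubar zbar ->
  in_Lp Omega (p / (p - 1)) xibar ->
  in_M Omega mubar ->
  optimality_system Omega s p alpha ud Zad ubar zbar xibar mubar ->
  is_reg_solution Omega s p alpha gamma ud muhat Zad ugam zgam ->
  alpha * L2norm Omega (zbar \- zgam) ^+ 2 +
    L2norm Omega (ubar \- ugam) ^+ 2 +
    gamma * L2norm Omega ugam^\+ ^+ 2 <=
  gamma^-1 * L2norm Omega muhat ^+ 2 + charge_integral mubar Omega ugam
  /\
  L2norm Omega ugam^\+ <=
  Num.sqrt (2 / gamma) *
  Num.sqrt (Num.max (gamma^-1 * L2norm Omega muhat ^+ 2)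
                    (charge_integral mubar Omega ugam^\+)).
Proof.
move=> _ [_ oO _ bO _] _ /andP[s0 _] a0 p2 _ Lud [_ ZLp _ Zconv] Lm m0 g0
  [[Zb Sb ub0] _] Lxi _ [opt1 opt2 [mu_ge0 _ mu_u]] [[Zg Sg] ug_min].
have mO := open_measurable_rV oO.
have p1 : 1 < p by rewrite (lt_le_trans _ p2)// ltr1n.
have Lzb := ZLp _ Zb; have Lzg := ZLp _ Zg.
have Wub : in_Ws20 Omega s ubar by case: Sb => -[].
have Wug : in_Ws20 Omega s ugam by case: Sg => -[].
have sub := Ws20_restrict oO Wub; have sug := Ws20_restrict oO Wug.
have /in_Lp2P sud := Lud; have /in_Lp2P sm := Lm.
have L2zb := in_Lp_in_L2 mO bO p2 Lzb; have L2zg := in_Lp_in_L2 mO bO p2 Lzg.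
have /in_Lp2P szb := L2zb; have /in_Lp2P szg := L2zg.
have L2ub : in_Lp Omega 2 ubar by exact/in_Lp2P.
have L2ug : in_Lp Omega 2 ugam by exact/in_Lp2P.
have first : alpha * L2norm Omega (zbar \- zgam) ^+ 2 +
    L2norm Omega (ubar \- ugam) ^+ 2 + gamma * L2norm Omega ugam^\+ ^+ 2 <=
    gamma^-1 * L2norm Omega muhat ^+ 2 + charge_integral mubar Omega ugam.
  have posE : ugam^\+ \_ Omega = (ugam \_ Omega)^\+.
    apply/funext => x; rewrite /funrpos !patchE; case: ifPn => // _.
    by rewrite maxxx.
  rewrite (L2norm_sub_sqr L2zb L2zg) (L2norm_sub_sqr L2ub L2ug) (L2norm_sqr Lm).
  rewrite L2norm_sqr; last first.
    by apply/in_Lp2P; rewrite posE; exact: square_integrable_pos.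
  rewrite posE.
  apply: (error_estimate g0 sud sm sug szg sub szb).
  - move: m0; apply: filterS => x mx; rewrite patchE.
    by case: ifPn => //; rewrite inE => /mx.
  - move=> x; rewrite patchE; case: ifPn => //; rewrite inE => Ox.
    by apply: ub0; exact: subset_closure.
  - apply: (reg_first_order g0 sud sm sug szg
      (square_integrable_sub sub sug) (square_integrable_sub szb szg)) => t t01.
    (* The segment from (ugam, zgam) to (ubar, zbar) is feasible. *)
    have Zt := Zconv _ _ _ Zb Zg t01.
    have St := state_comb s0 p2 oO bO Lzb Lzg (ZLp _ Zt) Sb Sg.
    have Wut : in_Ws20 Omega s (fun x => t * ubar x + (1 - t) * ugam x).
      by case: St => -[].
    have := ug_min _ _ (conj Zt St).
    rewrite (reg_costE alpha gamma Lud Lm L2ug L2zg).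
    rewrite (reg_costE alpha gamma Lud Lm _ (in_Lp_in_L2 mO bO p2 (ZLp _ Zt))); last first.
      by apply/in_Lp2P; exact: Ws20_restrict Wut.
    have combE (f g : 'rV[R]_N -> R) x :
      ((fun x => t * f x + (1 - t) * g x) \_ Omega) x =
      (g \_ Omega) x + t * ((f \_ Omega) x - (g \_ Omega) x).
      rewrite !patchE; case: ifPn => _; last by rewrite subrr mulr0 addr0.
      by rewrite mulrBl mul1r mulrBr addrC addrAC addrA.
    move/le_trans; apply; rewrite le_eqVlt; apply/orP; left; apply/eqP.
    by apply: eq_Rintegral => x _; rewrite !combE.
  - (* The adjoint equation may be tested with both states, whose images
       under (-Delta)^s_D are their controls. *)
    have Fb := state_fracLapD s0 p2 oO bO Lzb Sb.
    have Fg := state_fracLapD s0 p2 oO bO Lzg Sg.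
    have Eg := opt1 _ _ (proj1 Sg) Lzg Fg.
    have Eb := opt1 _ _ (proj1 Sb) Lzb Fb; rewrite mu_u addr0 in Eb.
    exact: (adjoint_inequality mO bO p2 Lud L2ub L2ug Lzb Lzg Lxi Eb Eg (opt2 _ Zg)).
split => //.
have ci_le : charge_integral mubar Omega ugam <= charge_integral mubar Omega ugam^\+.
  have [nu nuE] := charge_integral_ge0E mu_ge0 mO; rewrite !nuE.
  have Iu := C0_measure_integrable nu (Ws2_measurable (proj1 Wug)) oO bO
    (let: And3 _ c _ := proj1 Sg in c).
  apply: le_Rintegral => //; first exact: integrable_funrpos.
  by move=> x _; rewrite /funrpos le_max lexx.
set M := Num.max _ _; set P := L2norm Omega ugam^\+.
have P0 : 0 <= P by rewrite fine_ge0// Lnorm_ge0.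
have PM : gamma * P ^+ 2 <= M + M.
  apply: (@le_trans _ _ (gamma^-1 * L2norm Omega muhat ^+ 2 +
      charge_integral mubar Omega ugam)); last first.
    by apply: lerD; rewrite /M le_max ?lexx// ci_le orbT.
  apply: le_trans first; rewrite lerDr addr_ge0 ?sqr_ge0//.
  by apply: mulr_ge0; [exact: ltW|exact: sqr_ge0].
have c0 : 0 <= 2 / gamma by rewrite divr_ge0// ltW.
rewrite -sqrtrM// -[leLHS](ger0_norm P0) -sqrtr_sqr ler_wsqrtr//.
by rewrite mulrAC ler_pdivlMr// mulrC mulr2n mulrDl mul1r.
Qed.
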